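(* Let $\alpha<0$, let $\mathcal{A}\neq0$ be a real antisymmetric $n\times n$ matrix, let $\mathbf{C}:\mathbb{R}\to\mathbb{R}^n$ be a rotating-dilating soliton with parameters $(\alpha,\mathcal{A})$, let $\omega(\mathbf{X})$ be the $\omega$-limit set of the corresponding orbit $\mathbf{X}$, and let $V_+=\lim_{s\to\infty}V(\mathbf{C}(s),\mathbf{C}_s(s))$. If $V_+\neq0$, then $V_+=\pm\Omega_k/\sqrt{-e\alpha}$ for some $k$, and $\omega(\mathbf{X})$ consists of complex circles with radius $(-\alpha)^{-1/2}$ in the subspace $F_k$. In the special case that all eigenvalues $i\Omega_k$ of $\mathcal{A}$ are simple, the subspaces $F_k$ are two-dimensional and each contains exactly one soliton circle; when this happens (and $V_+\neq0$), $\omega(\mathbf{X})$ contains that circle and the soliton $\mathbf{C}$ is asymptotic to the circle as $s\to\infty$.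
   Context: For a nonzero vector $\mathbf{u}$, $\mathfrak{p}_{\mathbf{u}}(\mathbf{w})=\mathbf{w}-\frac{\langle\mathbf{w},\mathbf{u}\rangle}{\|\mathbf{u}\|^2}\mathbf{u}$. A rotating-dilating soliton with parameters $(\alpha,\mathcal{A})$ is an arc length parametrized curve $\mathbf{C}:\mathbb{R}\to\mathbb{R}^n$ with $\mathbf{C}_{ss}=\mathfrak{p}_{\mathbf{C}_s}[(\alpha+\mathcal{A})\mathbf{C}]$ ($\alpha$ stands for $\alpha$ times the identity); $\mathbf{T}=\mathbf{C}_s$. Its corresponding orbit is $\mathbf{X}=(\mathbf{P},\mathbf{T})\in\mathbb{B}^n\times\mathbb{S}^{n-1}$ with $\mathbf{P}=\mathbf{C}/\sqrt{1+\|\mathbf{C}\|^2}$ ($\mathbb{B}^n$ the closed unit ball), and $\omega(\mathbf{X})=\bigcap_{s>0}\overline{\{\mathbf{X}(s'):s'\geq s\}}$. The function $V(\mathbf{C},\mathbf{T})=e^{\frac{\alpha}{2}\|\mathbf{C}\|^2}\langle\mathbf{T},\mathcal{A}\mathbf{C}\rangle$ is bounded and nondecreasing along solitons, so $V_+$ exists. Let $0<\Omega_1<\dots<\Omega_{\bar m}$ be the distinct numbers such that $\pm\Omega_k$ are the nonzero eigenvalues of $i\mathcal{A}$, and $F_k=N(\mathcal{A}^2+\Omega_k^2\mathbf{1})$, with complex structure $\mathcal{J}_k=\Omega_k^{-1}\mathcal{A}|_{F_k}$. A complex circle with radius $r$ in $F_k$ is a circle centered at the origin with radius $r$ in a real 2-plane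 spanned by $\mathbf{x},\mathcal{J}_k\mathbf{x}$ ($0\ne\mathbf{x}\in F_k$); such circles with radius $(-\alpha)^{-1/2}$ are solitons (''soliton circles''). ''$\omega(\mathbf{X})$ consists of complex circles'' means that $\omega(\mathbf{X})$ is a union of the $(\mathbf{P},\mathbf{T})$-orbits of arc length parametrized such circles. *)

(* Defs.v *)
From HB Require Import structures.
From mathcomp Require Import all_boot all_order all_algebra.
From mathcomp Require Import complex.
From mathcomp Require Import all_classical all_reals all_analysis.

Set Implicit Arguments.
Unset Strict Implicit.
Unset Printing Implicit Defensive.

Import Order.TTheory GRing.Theory Num.Theory.
Import numFieldNormedType.Exports.

Local Open Scope classical_set_scope.
Local Open Scope ring_scope.

(* Vectors of R^n are columns.  The library norm on 'cV[R]_n is the sup norm,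
   hence the separate Euclidean norm; both induce the same topology. *)
Definition dotv (R : realType) (n : nat) (u v : 'cV[R]_n) : R :=
  \sum_(i < n) u i 0 * v i 0.

Definition enorm (R : realType) (n : nat) (u : 'cV[R]_n) : R :=
  Num.sqrt (dotv u u).

Definition proj_orth (R : realType) (n : nat) (u w : 'cV[R]_n) : 'cV[R]_n :=
  w - (dotv w u / enorm u ^+ 2) *: u.

Definition arclength_param (R : realType) (n : nat) (C : R -> 'cV[R]_n) : Prop :=
  forall s, derivable C s 1 /\ enorm (derive1 C s) = 1.

Definition soliton (R : realType) (n : nat) (alpha : R) (A : 'M[R]_n)
    (C : R -> 'cV[R]_n) : Prop :=
  arclength_param C /\
  forall s, derivable (derive1 C) s 1 /\
    derive1 (derive1 C) s = proj_orth (derive1 C s) ((alpha%:M + A) *m C s).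

Definition ball_map (R : realType) (n : nat) (x : 'cV[R]_n) : 'cV[R]_n :=
  (Num.sqrt (1 + enorm x ^+ 2))^-1 *: x.

Definition orbit_PT (R : realType) (n : nat) (C : R -> 'cV[R]_n) (s : R) :
    'cV[R]_n * 'cV[R]_n :=
  (ball_map (C s), derive1 C s).

(* Closures of orbits are taken in R^n x R^n, in which the product of the closed
   unit ball and the unit sphere is closed. *)
Definition omega_limit (R : realType) (T : topologicalType) (X : R -> T) : set T :=
  \bigcap_(s in [set s : R | 0 < s]) closure (X @` [set s' : R | s <= s']).

Definition Vfun (R : realType) (n : nat) (alpha : R) (A : 'M[R]_n)
    (x t : 'cV[R]_n) : R :=
  expR (alpha / 2 * enorm x ^+ 2) * dotv t (A *m x).

Definition Vplus (R : realType) (n : nat) (alpha : R) (A : 'M[R]_n)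
    (C : R -> 'cV[R]_n) : R :=
  lim (Vfun alpha A (C s) (derive1 C s) @[s --> +oo]).

Definition complex_mx (R : realType) (n : nat) (A : 'M[R]_n) : 'M[R[i]]_n :=
  map_mx (real_complex R) A.

(* [eigenvalue] is stated with row vectors; a square matrix has the same
   eigenvalues on rows and on columns. *)
Definition frequencies (R : realType) (n : nat) (A : 'M[R]_n) (m : nat)
    (Omega : 'I_m -> R) : Prop :=
  [/\ forall k, 0 < Omega k,
      forall k l : 'I_m, (k < l)%N -> Omega k < Omega l &
      forall z : R[i],
        (z != 0 /\ eigenvalue (Complex 0 1 *: complex_mx A) z) <->
        (exists k, z = Complex (Omega k) 0 \/ z = - Complex (Omega k) 0)].

Definition freq_space (R : realType) (n : nat) (A : 'M[R]_n) (w : R) :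
    {vspace 'cV[R]_n} :=
  lker (linfun (mulmx (A *m A + (w ^+ 2)%:M))).

Definition simple_eigenvalue (F : fieldType) (n : nat) (B : 'M[F]_n) (z : F) :
    Prop :=
  mup z (char_poly B) = 1%N.

Definition complex_circle (R : realType) (n : nat) (A : 'M[R]_n) (w r : R)
    (S : set 'cV[R]_n) : Prop :=
  exists x : 'cV[R]_n,
    [/\ x \in freq_space A w, x != 0 &
        S = [set y | y \in <<[:: x; w^-1 *: (A *m x)]>>%VS /\ enorm y = r]].

Definition parametrized_complex_circle (R : realType) (n : nat) (A : 'M[R]_n)
    (w r : R) (c : R -> 'cV[R]_n) : Prop :=
  arclength_param c /\ complex_circle A w r (range c).

Definition consists_of_complex_circles (R : realType) (n : nat) (A : 'M[R]_n)
    (w r : R) (W : set ('cV[R]_n * 'cV[R]_n)) : Prop :=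
  exists2 G : set (R -> 'cV[R]_n),
    (forall c, G c -> parametrized_complex_circle A w r c) &
    W = \bigcup_(c in G) range (orbit_PT c).

(* A circle in R^n lies in a set of (P, T) pairs through the orbit of one of its
   arc length parametrizations: its two orientations give different orbits. *)
Definition contains_circle (R : realType) (n : nat)
    (W : set ('cV[R]_n * 'cV[R]_n)) (S : set 'cV[R]_n) : Prop :=
  exists c : R -> 'cV[R]_n,
    [/\ arclength_param c, range c = S & range (orbit_PT c) `<=` W].

Definition asymptotic_to (R : realType) (n : nat) (C : R -> 'cV[R]_n)
    (S : set 'cV[R]_n) : Prop :=
  forall eps : R, 0 < eps ->
    \forall s \near +oo, exists2 y, S y & enorm (C s - y) < eps.

Definition soliton_radius (R : realType) (alpha : R) : R :=
  (Num.sqrt (- alpha))^-1.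

Definition soliton_circle (R : realType) (n : nat) (alpha : R) (A : 'M[R]_n)
    (w : R) (S : set 'cV[R]_n) : Prop :=
  complex_circle A w (soliton_radius alpha) S.

(* Main.v *)
Require Import Defs.
From HB Require Import structures.
From mathcomp Require Import all_boot all_order all_algebra.
From mathcomp Require Import complex.
From mathcomp Require Import all_classical all_reals all_analysis.
From mathcomp Require Import ring lra.
Import Order.TTheory GRing.Theory Num.Theory.
Import numFieldNormedType.Exports.
Set Implicit Arguments.
Unset Strict Implicit.
Unset Printing Implicit Defensive.
Local Open Scope classical_set_scope.
Local Open Scope ring_scope.

(** Write T = C', lam = <T, A C> and w = A C - lam T.  Differentiating V along
    the soliton gives V' = exp(alpha/2 |C|^2) |w|^2, so V is nondecreasing; it
    is bounded because alpha < 0, hence V_+ exists.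

    Assume V_+ <> 0.  Then |V| is eventually bounded below, which bounds |C|
    and keeps |lam| away from 0, and all functions in play are eventually
    bounded and Lipschitz.  Barbalat's lemma ([barbalat]: a convergent function
    with a Lipschitz derivative has derivative tending to 0) replaces the
    study of limit solutions of the differential equation:
    - applied to V it gives w -> 0; as <C, A C> = 0 this yields <C, T> -> 0,
      T' - alpha C -> 0 and lam' -> 0;
    - applied to w it gives A T - lam alpha C -> 0, hence
      A^2 C - alpha lam^2 C -> 0; pairing with C, |C|^2 -> - 1/alpha, and so
      lam -> L := V_+ exp(1/2).
    Every omega-limit point therefore comes from a pair (x, t) with |t| = 1,
    |x|^2 = - 1/alpha, A x = L t and A^2 x = alpha L^2 x ([limit_state]).
    Thus - alpha L^2 = Omega_k^2 for some k, which is the formula for V_+, and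
    x lies in F_k.

    Since T' - alpha C -> 0, the pair (C, T) follows, over each fixed time lag
    and up to a vanishing error, the harmonic oscillator c'' = alpha c
    ([null_rotation]).  So the omega-limit set contains the whole oscillator
    orbit issued from the limit state (x, t) of each of its points, and that
    orbit parametrizes the complex circle of radius (- alpha)^(-1/2) through x
    ([range_osc]).

    When the eigenvalues are simple, the geometric multiplicity is 1
    ([corank_le_mup]); a real x in F_k gives the complex eigenvector x + i J x,
    so F_k is spanned by x and J x for every nonzero x in it, and it contains
    only one circle of the given radius.  Convergence of C to this circle
    follows by compactness: if it failed, some omega-limit point would be the
    limit of (P, T) along times at which C is far from the circle. *)

(** * Euclidean scalar product *)

Section EuclideanDot.
Context {R : realType} {n : nat}.
Implicit Types (u v w : 'cV[R]_n) (A : 'M[R]_n).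

Lemma dotvC u v : dotv u v = dotv v u.
Proof. by apply: eq_bigr => i _; rewrite mulrC. Qed.

Lemma dotvDl u v w : dotv (u + v) w = dotv u w + dotv v w.
Proof. by rewrite -big_split; apply: eq_bigr => i _; rewrite mxE mulrDl. Qed.

Lemma dotvZl (a : R) u w : dotv (a *: u) w = a * dotv u w.
Proof.
by rewrite /dotv mulr_sumr; apply: eq_bigr => i _; rewrite mxE mulrA.
Qed.

Lemma dotvNl u w : dotv (- u) w = - dotv u w.
Proof. by rewrite -scaleN1r dotvZl mulN1r. Qed.

Lemma dotvBl u v w : dotv (u - v) w = dotv u w - dotv v w.
Proof. by rewrite dotvDl dotvNl. Qed.

Lemma dotvDr u v w : dotv w (u + v) = dotv w u + dotv w v.
Proof. by rewrite dotvC dotvDl !(dotvC w). Qed.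

Lemma dotvZr (a : R) u w : dotv w (a *: u) = a * dotv w u.
Proof. by rewrite dotvC dotvZl (dotvC w). Qed.

Lemma dotvNr u w : dotv w (- u) = - dotv w u.
Proof. by rewrite dotvC dotvNl (dotvC w). Qed.

Lemma dotvBr u v w : dotv w (u - v) = dotv w u - dotv w v.
Proof. by rewrite dotvDr dotvNr. Qed.

Lemma dotv_ge0 u : 0 <= dotv u u.
Proof. by apply: sumr_ge0 => i _; exact: sqr_ge0. Qed.

Lemma dotv_eq0 u : (dotv u u == 0) = (u == 0).
Proof.
apply/eqP/eqP => [u0|->]; last first.
  by rewrite /dotv big1// => i _; rewrite mxE mul0r.
apply/matrixP => i j; rewrite ord1 mxE; apply/eqP; rewrite -sqrf_eq0 expr2.
have := u0 => /eqP; rewrite psumr_eq0 => [/allP/(_ i)|k _]; last exact: sqr_ge0.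
by rewrite mem_index_enum => /(_ isT).
Qed.

Lemma sqr_coord_le_dotv u i : u i 0 ^+ 2 <= dotv u u.
Proof.
by rewrite /dotv (bigD1 i)//= -expr2 lerDl sumr_ge0// => j _; exact: sqr_ge0.
Qed.

Lemma enorm_sqr u : enorm u ^+ 2 = dotv u u.
Proof. by rewrite sqr_sqrtr// dotv_ge0. Qed.

Lemma dotv_mulmx A u v : dotv (A *m u) v = dotv u (A^T *m v).
Proof.
have E (x y : 'cV[R]_n) : dotv x y = (x^T *m y) 0 0.
  by rewrite !mxE; apply: eq_bigr => i _; rewrite mxE.
by rewrite !E trmx_mul mulmxA.
Qed.

Lemma dotv_skew A u v : A^T = - A -> dotv (A *m u) v = - dotv u (A *m v).
Proof. by move=> As; rewrite dotv_mulmx As mulNmx dotvNr. Qed.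

Lemma dotv_skew0 A u : A^T = - A -> dotv u (A *m u) = 0.
Proof. by move=> As; have := dotv_skew u u As; rewrite dotvC; lra. Qed.

(** A linear map is bounded for the Euclidean norm. *)
Lemma mulmx_bounded A :
  exists2 K : R, 0 <= K & forall u, dotv (A *m u) (A *m u) <= K * dotv u u.
Proof.
exists (\sum_i (\sum_j `|A i j|) ^+ 2) => [|u].
  by apply: sumr_ge0 => i _; exact: sqr_ge0.
rewrite [leLHS]/dotv mulr_suml; apply: ler_sum => i _.
rewrite -expr2 -(enorm_sqr u) -exprMn -real_normK ?num_real//.
have e0 : 0 <= enorm u by exact: sqrtr_ge0.
have S0 : 0 <= \sum_j `|A i j| by exact: sumr_ge0.
rewrite ler_pXn2r ?nnegrE ?mulr_ge0//.
rewrite !mxE mulr_suml; apply: le_trans (ler_norm_sum _ _ _) _.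
apply: ler_sum => j _; rewrite normrM ler_wpM2l//.
by rewrite -sqrtr_sqr ler_wsqrtr// sqr_coord_le_dotv.
Qed.

End EuclideanDot.

(** * Frequency spaces and complex eigenvectors *)

Section FreqSpace.
Context {R : realType} {n : nat}.
Implicit Types (u v x : 'cV[R]_n) (A : 'M[R]_n) (w : R).

Lemma freq_spaceP A w x :
  reflect (A *m (A *m x) = - (w ^+ 2) *: x) (x \in freq_space A w).
Proof.
rewrite memv_ker lfunE /= mulmxDl mul_scalar_mx -mulmxA addr_eq0 scaleNr.
exact: eqP.
Qed.

(** The complex row vector with real part [u] and imaginary part [v]. *)
Definition cvec u v : 'rV[R[i]]_n := \row_j Complex (u j 0) (v j 0).

Lemma cvecE (z : 'rV[R[i]]_n) : exists u v, z = cvec u v.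
Proof.
exists (\col_j complex.Re (z 0 j)), (\col_j complex.Im (z 0 j)).
by apply/rowP => j; rewrite !mxE; case: (z 0 j).
Qed.

Lemma cvec_inj u v u' v' : cvec u v = cvec u' v' -> u = u' /\ v = v'.
Proof.
move=> /rowP E; split; apply/colP => j; have := E j; rewrite !mxE => -[]//.
Qed.

Lemma cvec_eq0 u v : (cvec u v == 0) = (u == 0) && (v == 0).
Proof.
apply/eqP/andP => [E|[/eqP-> /eqP->]]; last by apply/rowP => j; rewrite !mxE.
suff [-> ->] : u = 0 /\ v = 0 by rewrite eqxx.
by apply: cvec_inj; rewrite E; apply/rowP => j; rewrite !mxE.
Qed.

Lemma scale_cvec a b u v :
  Complex a b *: cvec u v = cvec (a *: u - b *: v) (a *: v + b *: u).
Proof. by apply/rowP => j; rewrite !mxE. Qed.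

Lemma cvec_mul A u v : A^T = - A ->
  cvec u v *m complex_mx A = cvec (- (A *m u)) (- (A *m v)).
Proof.
move=> As; rewrite -!mulNmx -As; apply/rowP => j; rewrite !mxE.
transitivity (\sum_k Complex (A^T j k * u k 0) (A^T j k * v k 0)).
  apply: eq_bigr => k _; rewrite !mxE /=; apply/eqP; rewrite eq_complex /=.
  by rewrite !mulr0 subr0 add0r mulrC eqxx mulrC eqxx.
by elim/big_rec3 : _ => // k a b c _ ->.
Qed.

(** For A antisymmetric, a nonzero w is an eigenvalue of i A if and only if the
    frequency space of w is nonzero: the imaginary part of an eigenvector lies
    in it. *)
Lemma eigenvalue_freq A w : A^T = - A -> w != 0 ->
  eigenvalue (Complex 0 1 *: complex_mx A) (Complex w 0) <->
  exists2 x, x != 0 & x \in freq_space A w.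
Proof.
move=> As w0; split.
  move=> /eigenvalueP[z]; have [u [v ->]] := cvecE z.
  rewrite -scalemxAr (cvec_mul _ _ As) !scale_cvec !scale0r !scale1r.
  rewrite !add0r !addr0 opprK subr0 => /cvec_inj[E1 E2] uv0.
  exists v; last first.
    apply/freq_spaceP; rewrite E1 -scalemxAr -[A *m u]opprK E2.
    by rewrite scalerN scalerA scaleNr expr2.
  apply: contraNneq uv0 => v0; move/eqP: E1.
  by rewrite cvec_eq0 v0 mulmx0 eq_sym scaler_eq0 (negPf w0) /= eqxx andbT.
move=> [x x0 /freq_spaceP xF]; apply/eigenvalueP.
exists (cvec (w^-1 *: (A *m x)) x); last first.
  by rewrite cvec_eq0 (negPf x0) andbF.
rewrite -scalemxAr (cvec_mul _ _ As) !scale_cvec !scale0r !scale1r.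
rewrite !add0r !addr0 opprK subr0 scalerA divff// scale1r.
congr cvec; rewrite -scalemxAr xF scalerA -scaleNr; congr (_ *: _); field.
exact: w0.
Qed.

End FreqSpace.

(** The geometric multiplicity of an eigenvalue is at most the algebraic one. *)
Lemma corank_le_mup (F : fieldType) (n : nat) (B : 'M[F]_n) (z : F) :
  (n - \rank (B - z%:M)%R <= mup z (char_poly B))%N.
Proof.
rewrite mup_geq ?monic_neq0 ?char_poly_monic//.
(* with B - z = L (pid_mx r) U, the last n - r rows of
   ('X - z) L^-1 U^-1 - pid_mx r are divisible by 'X - z *)
set r := \rank _; set N := B - z%:M; pose Y : {poly F} := 'X - z%:P.
pose L := col_ebase N; pose U := row_ebase N.
pose M := invmx L *m invmx U.
pose D : 'rV[{poly F}]_n := \row_i (if (i < r)%N then 1 else Y).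
pose Q : 'M[{poly F}]_n := \matrix_(i, j) (if (i < r)%N then
  Y * (M i j)%:P - ((pid_mx r : 'M[F]_n) i j)%:P else (M i j)%:P).
have cpE : char_poly_mx B =
    map_mx polyC L *m (diag_mx D *m Q) *m map_mx polyC U.
  have -> : diag_mx D *m Q = Y *: map_mx polyC M - map_mx polyC (pid_mx r).
    apply/matrixP => i j; rewrite mul_diag_mx !mxE.
    by case: ifP => ir; rewrite ?mul1r ?andbF ?subr0.
  rewrite mulmxBr mulmxBl -scalemxAr -scalemxAl -!map_mxM /=.
  rewrite mulmxA mulmxV ?col_ebase_unit// mul1mx mulVmx ?row_ebase_unit//.
  rewrite mulmx_ebase /char_poly_mx.
  apply/matrixP => i j; rewrite !mxE rmorphB /=; case: (i == j).
    by rewrite !mulr1n /Y; ring.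
  by rewrite !mulr0n /Y polyC0; ring.
have -> : ('X - z%:P) ^+ (n - r) = \prod_i D 0 i.
  under eq_bigr do rewrite mxE.
  rewrite -(big_mkord xpredT (fun i => if (i < r)%N then 1 else Y)).
  rewrite (big_cat_nat (n := r))/= ?rank_leq_row// [X in X * _]big_nat.
  rewrite big1 => [|i /andP[_ ->]//]; rewrite mul1r.
  rewrite -prodr_const_nat; apply: eq_big_nat => i /andP[ri _].
  by rewrite ltnNge ri.
rewrite /char_poly cpE !det_mulmx det_diag.
by apply/dvdp_mulr/dvdp_mull/dvdp_mulr.
Qed.

Section SimpleFrequency.
Context {R : realType} {n : nat}.
Implicit Types (u v x y : 'cV[R]_n) (A : 'M[R]_n) (w : R).

(** With J = w^-1 A, a vector [y] of the frequency space gives the complex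
    eigenvector y + i J y; simplicity makes it a complex multiple of x + i J x,
    so that y is a real combination of x and J x. *)
Lemma freq_space_simple A w x : A^T = - A -> w != 0 ->
  simple_eigenvalue (complex_mx A) (Complex 0 w) ->
  x \in freq_space A w -> x != 0 ->
  freq_space A w = <<[:: x; w^-1 *: (A *m x)]>>%VS.
Proof.
move=> As w0 simple xF x0.
pose J y := w^-1 *: (A *m y).
have JF y : y \in freq_space A w -> J y \in freq_space A w.
  move=> /freq_spaceP yF; apply/freq_spaceP.
  by rewrite /J -!scalemxAr yF -scalemxAr !scalerA mulrC.
have eigJ y : y \in freq_space A w ->
    (cvec y (J y) <= eigenspace (complex_mx A) (Complex 0 w))%MS.
  move=> /freq_spaceP yF; apply/eigenspaceP.
  rewrite cvec_mul// scale_cvec /J -scalemxAr yF !scale0r sub0r add0r.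
  by rewrite !scalerA; congr cvec; rewrite -scaleNr; [rewrite divff//|];
    [rewrite scaleN1r|congr (_ *: _); field].
have rk1 : (\rank (eigenspace (complex_mx A) (Complex 0 w))%R <= 1)%N.
  by rewrite mxrank_ker (leq_trans (corank_le_mup _ _))// simple.
apply/eqP; rewrite eqEsubv; apply/andP; split; last first.
  by apply/span_subvP => y; rewrite !inE => /orP[]/eqP->//; exact: JF.
apply/subvP => y yF.
have gen : (eigenspace (complex_mx A) (Complex 0 w) <= cvec x (J x))%MS.
  rewrite -(geq_leqif (mxrank_leqif_sup (eigJ x xF))) (leq_trans rk1)//.
  by rewrite lt0n mxrank_eq0 cvec_eq0 (negPf x0).
have /sub_rVP[[a b]] := submx_trans (eigJ y yF) gen.
rewrite scale_cvec => /cvec_inj[-> _].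
by rewrite span_cons span_seq1 memv_add// ?memvN memvZ// memv_line.
Qed.

Lemma dim_freq_space_simple A w x : A^T = - A -> w != 0 ->
  simple_eigenvalue (complex_mx A) (Complex 0 w) ->
  x \in freq_space A w -> x != 0 -> \dim (freq_space A w) = 2%N.
Proof.
move=> As w0 simple xF x0; rewrite (freq_space_simple As w0 simple xF x0).
suff /eqP -> : free [:: x; w^-1 *: (A *m x)] by [].
rewrite free_cons seq1_free span_seq1 scaler_eq0 invr_eq0 (negPf w0) /=.
apply/andP; split.
  apply: contra x0 => /vlineP[k xE]; rewrite -dotv_eq0 {2}xE.
  by rewrite !dotvZr dotv_skew0// !mulr0.
apply: contra x0 => /eqP Ax; move/freq_spaceP: xF;
  rewrite Ax mulmx0 => /esym/eqP.
by rewrite scaler_eq0 oppr_eq0 sqrf_eq0 (negPf w0).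
Qed.

End SimpleFrequency.

(** * Real functions at infinity *)

Section Asymptotics.
Context {R : realType}.
Implicit Types (f g : R -> R) (s t a e M : R).

Lemma near_pinftyP (P : R -> Prop) :
  (\forall s \near +oo, P s) <-> exists a, forall s, a <= s -> P s.
Proof.
split=> [[a [_ aP]]|[a aP]].
  by exists (a + 1) => s sa; apply: aP; rewrite (lt_le_trans _ sa)// ltrDl.
by exists a; split; [exact: num_real|move=> s /ltW; exact: aP].
Qed.

(** Functions tending to 0 at infinity. *)
Definition null f := f s @[s --> +oo] --> (0 : R).

(** Functions that are bounded and Lipschitz on some half-line, with the same
    constant for both bounds. *)
Definition tame f := exists M a, forall s, a <= s ->
  `|f s| <= M /\ forall t, a <= t -> `|f s - f t| <= M * `|s - t|.

Lemma nullP f :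
  null f <-> forall e : R, 0 < e -> exists a, forall s, a <= s -> `|f s| <= e.
Proof.
split=> [/cvgr0Pnorm_le fP e /fP/near_pinftyP//|fP].
by apply/cvgr0Pnorm_le => e /fP/near_pinftyP.
Qed.

Lemma eq_cvg_pinfty f g (l : R) : f =1 g ->
  f s @[s --> +oo] --> l -> g s @[s --> +oo] --> l.
Proof. by move=> /funext ->. Qed.

Lemma eq_null f g : f =1 g -> null f -> null g.
Proof. exact: eq_cvg_pinfty. Qed.

Lemma nullD f g : null f -> null g -> null (fun s => f s + g s).
Proof. by move=> nf ng; rewrite /null -[0]addr0; exact: cvgD nf ng. Qed.

Lemma nullN f : null f -> null (fun s => - f s).
Proof. by move=> nf; rewrite /null -[0]oppr0; exact: cvgN nf. Qed.

Lemma nullB f g : null f -> null g -> null (fun s => f s - g s).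
Proof. by move=> nf ng; apply: nullD => //; exact: nullN. Qed.

Lemma null_sum n (h : 'I_n -> R -> R) :
  (forall i, null (h i)) -> null (fun s => \sum_i h i s).
Proof.
elim: n h => [|n IH] h nh.
  by under eq_fun do rewrite big_ord0; exact: cvg_cst.
by under eq_fun do rewrite big_ord_recr; apply: nullD => //; exact: IH.
Qed.

Lemma null_mul_bounded f g M :
  (\forall s \near +oo, `|g s| <= M) -> null f -> null (fun s => f s * g s).
Proof.
move=> /near_pinftyP[a gM] /nullP nf; apply/nullP => e e0.
have M0 : 0 < `|M| + 1 by rewrite ltr_pwDr.
have [b fb] := nf _ (divr_gt0 e0 M0).
exists (Num.max a b) => s; rewrite ge_max => /andP[sa sb].
rewrite normrM -[leRHS](divfK (lt0r_neq0 M0)) ler_pM ?fb//.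
rewrite (le_trans (gM s sa))// (le_trans (ler_norm _))//.
by rewrite lerDl.
Qed.

Lemma null_mul f g : null f -> tame g -> null (fun s => f s * g s).
Proof.
move=> nf [M [a gM]]; apply: (null_mul_bounded (M := M)) nf.
by apply/near_pinftyP; exists a => s /gM[].
Qed.

Lemma null_mull f g : tame f -> null g -> null (fun s => f s * g s).
Proof.
by move=> tf ng; apply: eq_null (null_mul ng tf) => s; rewrite mulrC.
Qed.

Lemma null_cancel f g c : 0 < c -> (\forall s \near +oo, c <= `|g s|) ->
  null (fun s => g s * f s) -> null f.
Proof.
move=> c0 /near_pinftyP[a ga] /nullP nf; apply/nullP => e e0.
have [b fb] := nf _ (mulr_gt0 c0 e0); exists (Num.max a b) => s.
rewrite ge_max => /andP[sa sb]; rewrite -(ler_pM2l c0).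
by apply: le_trans (fb s sb); rewrite normrM ler_wpM2r// ga.
Qed.

Lemma null_sqr f : null (fun s => f s ^+ 2) -> null f.
Proof.
move=> /nullP nf; apply/nullP => e e0.
have [b fb] := nf _ (exprn_gt0 2 e0); exists b => s /fb.
by rewrite normrX ler_pXn2r// nnegrE// ltW.
Qed.

Lemma null_le f g : (forall s, `|f s| <= g s) -> null g -> null f.
Proof.
move=> fg /nullP ng; apply/nullP => e /ng[a ga]; exists a => s /ga gs.
exact: le_trans (fg s) (le_trans (ler_norm _) gs).
Qed.

Lemma tameP f : tame f -> exists M a, [/\ 0 < M,
  forall s, a <= s -> `|f s| <= M &
  forall s t, a <= s -> a <= t -> `|f s - f t| <= M * `|s - t|].
Proof.
move=> [M [a fM]]; exists (`|M| + 1), a.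
have MM : M <= `|M| + 1 by rewrite (le_trans (ler_norm _))// lerDl.
split=> [|s /fM[fs _]|s t /fM[_ fs] /fs fst]; first by rewrite ltr_pwDr.
  exact: le_trans fs MM.
by apply: le_trans fst _; rewrite ler_wpM2r.
Qed.

Lemma tame_cst (k : R) : tame (fun=> k).
Proof.
by exists `|k|, 0 => s _; split=> // t _; rewrite subrr normr0 mulr_ge0.
Qed.

Lemma tameD f g : tame f -> tame g -> tame (fun s => f s + g s).
Proof.
move=> [M [a fM]] [N [b gN]]; exists (M + N), (Num.max a b) => s.
rewrite ge_max => /andP[/fM[f1 f2] /gN[g1 g2]]; split=> [|t].
  by apply: le_trans (ler_normD _ _) _; exact: lerD.
rewrite ge_max => /andP[/f2 f3 /g2 g3]; rewrite opprD addrACA mulrDl.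
by apply: le_trans (ler_normD _ _) _; exact: lerD.
Qed.

Lemma tameM f g : tame f -> tame g -> tame (fun s => f s * g s).
Proof.
move=> /tameP[M [a [M0 f1 f2]]] /tameP[N [b [N0 g1 g2]]].
exists (M * N + M * N), (Num.max a b) => s.
rewrite ge_max => /andP[sa sb]; split=> [|t].
  rewrite normrM (le_trans (ler_pM _ _ (f1 s sa) (g1 s sb)))//.
  by rewrite lerDl mulr_ge0// ltW.
rewrite ge_max => /andP[ta tb].
have -> : f s * g s - f t * g t = f s * (g s - g t) + (f s - f t) * g t by ring.
apply: le_trans (ler_normD _ _) _; rewrite !normrM mulrDl; apply: lerD.
  by rewrite -mulrA ler_pM ?f1 ?g2.
by rewrite -mulrA (mulrC N) mulrA ler_pM ?f2 ?g1.
Qed.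

Lemma tameN f : tame f -> tame (fun s => - f s).
Proof.
move=> tf; have := tameM (tame_cst (-1)) tf.
by under eq_fun do rewrite mulN1r.
Qed.

Lemma tameB f g : tame f -> tame g -> tame (fun s => f s - g s).
Proof. by move=> tf tg; apply: tameD => //; exact: tameN. Qed.

Lemma tame_sum n (h : 'I_n -> R -> R) :
  (forall i, tame (h i)) -> tame (fun s => \sum_i h i s).
Proof.
elim: n h => [|n IH] h th.
  by under eq_fun do rewrite big_ord0; exact: tame_cst.
by under eq_fun do rewrite big_ord_recr; apply: tameD => //; exact: IH.
Qed.

Lemma MVT_is_derive (f f' : R -> R) s t :
  (forall r : R, is_derive r (1 : R) f (f' r)) -> s <= t ->
  exists2 c, s <= c <= t & f t - f s = f' c * (t - s).
Proof.
move=> df st; have [c|c cst ->] := MVT_segment st (fun r _ => df r).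
  apply: continuous_subspaceT => r.
  exact/differentiable_continuous/derivable1_diffP/ex_derive.
by exists c => //; move: cst; rewrite in_itv.
Qed.

Lemma tame_derive (f f' : R -> R) M a :
  (forall s : R, is_derive s (1 : R) f (f' s)) ->
  (forall s, a <= s -> `|f s| <= M) -> (forall s, a <= s -> `|f' s| <= M) ->
  tame f.
Proof.
move=> df fM f'M; exists M, a => s sa; split=> [|t ta]; first exact: fM.
wlog st : s t sa ta / s <= t => [H|].
  by have [/H->//|/ltW/H H'] := leP s t; rewrite distrC (distrC s) H'.
have [c /andP[sc _] E] := MVT_is_derive df st.
by rewrite distrC E normrM (distrC s) ler_wpM2r// f'M// (le_trans sa).
Qed.

(** A function whose derivative tends to 0 is asymptotically invariant under
    every fixed shift. *)
Lemma null_shift (f f' : R -> R) (tau : R) :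
  (forall s : R, is_derive s (1 : R) f (f' s)) -> null f' ->
  null (fun s => f (s + tau) - f s).
Proof.
move=> df /nullP nf'; apply/nullP => e e0.
have t0 : 0 < `|tau| + 1 by rewrite ltr_pwDr.
have [b f'b] := nf' _ (divr_gt0 e0 t0); exists (b + `|tau|) => s sb.
have [c [cb ->]] : exists c, b <= c /\ f (s + tau) - f s = f' c * tau.
  have := normr_ge0 tau; have := ler_norm tau; have := ler_norm (- tau).
  rewrite normrN => t1 t2 t3; have [tau0|/ltW tau0] := leP 0 tau.
    have [|c /andP[sc _] E] := @MVT_is_derive f f' s (s + tau) df.
      by rewrite lerDl.
    by exists c; split; [lra|rewrite E; ring].
  have [|c /andP[sc _] E] := @MVT_is_derive f f' (s + tau) s df.
    by rewrite gerDl.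
  by exists c; split; [lra|rewrite -opprB E; ring].
rewrite normrM -[leRHS](divfK (lt0r_neq0 t0)) ler_pM ?f'b//.
by rewrite lerDl.
Qed.

(** Barbalat's lemma. *)
Lemma barbalat (f f' : R -> R) (l : R) :
  (forall s : R, is_derive s (1 : R) f (f' s)) -> f s @[s --> +oo] --> l ->
  tame f' ->
  null f'.
Proof.
move=> df fl /tameP[M [a [M0 _ f'M]]]; apply/nullP => e e0.
(* on an interval of length d the derivative varies by at most e / 2 *)
pose d := e / (2 * M).
have d0 : 0 < d by rewrite divr_gt0// mulr_gt0.
have e4 : 0 < d * (e / 4) by rewrite mulr_gt0// divr_gt0.
have [b fb] := (near_pinftyP _).1 ((cvgrPdist_le _ _).1 fl _ e4).
exists (Num.max a b) => s; rewrite ge_max => /andP[sa sb].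
have sd : s <= s + d by rewrite lerDl ltW.
have [c /andP[sc cd] E] := MVT_is_derive df sd.
have f'c : `|f' c| <= e / 2.
  rewrite -(ler_pM2r d0) -[in leLHS](gtr0_norm d0) -normrM.
  have -> : f' c * d = (l - f s) - (l - f (s + d)).
    by have := E; rewrite addrAC subrr add0r => <-; ring.
  apply: le_trans (ler_normB _ _) _.
  apply: le_trans (lerD (fb _ sb) (fb _ (le_trans sb sd))) _; lra.
have f's := f'M s c sa (le_trans sa sc).
have -> : f' s = (f' s - f' c) + f' c by ring.
apply: le_trans (ler_normD _ _) _.
have : M * `|s - c| <= e / 2.
  have -> : e / 2 = M * d by rewrite /d; field; exact: lt0r_neq0.
  by rewrite ler_pM2l// distrC ger0_norm ?subr_ge0// lerBlDl.
lra.
Qed.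

Lemma is_derive_add f g s a b :
  is_derive s (1 : R) f a -> is_derive s (1 : R) g b ->
  is_derive s (1 : R) (fun t => f t + g t) (a + b).
Proof. exact: is_deriveD. Qed.

Lemma is_derive_sub f g s a b :
  is_derive s (1 : R) f a -> is_derive s (1 : R) g b ->
  is_derive s (1 : R) (fun t => f t - g t) (a - b).
Proof. exact: is_deriveB. Qed.

Lemma is_derive_mul f g s a b :
  is_derive s (1 : R) f a -> is_derive s (1 : R) g b ->
  is_derive s (1 : R) (fun t => f t * g t) (a * g s + f s * b).
Proof.
move=> df dg; have := is_deriveM df dg; rewrite addrC [g s *: a]mulrC.
exact.
Qed.

Lemma is_derive_bigsum n (h : 'I_n -> R -> R) s (dh : 'I_n -> R) :
  (forall i, is_derive s (1 : R) (h i) (dh i)) ->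
  is_derive s (1 : R) (fun t => \sum_i h i t) (\sum_i dh i).
Proof. by move=> /is_derive_sum; rewrite fct_sumE. Qed.

End Asymptotics.

(** * Vector-valued functions, coordinatewise *)

Section VectorCalculus.
Context {R : realType} {n : nat}.
Implicit Types (u v : R -> 'cV[R]_n) (f : R -> R) (A : 'M[R]_n).

(** All coordinates tend to 0 at infinity. *)
Definition nullv u := forall i, null (fun s => u s i 0).

(** All coordinates are tame. *)
Definition tamev u := forall i, tame (fun s => u s i 0).

Lemma eq_nullv u v : u =1 v -> nullv u -> nullv v.
Proof. by move=> /funext ->. Qed.

Lemma nullvD u v : nullv u -> nullv v -> nullv (fun s => u s + v s).
Proof.
by move=> nu nv i; under eq_fun do rewrite mxE; exact: nullD (nu i) (nv i).
Qed.

Lemma nullvB u v : nullv u -> nullv v -> nullv (fun s => u s - v s).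
Proof.
by move=> nu nv i; under eq_fun do rewrite !mxE; exact: nullB (nu i) (nv i).
Qed.

Lemma nullvZ f u : tame f -> nullv u -> nullv (fun s => f s *: u s).
Proof.
by move=> tf nu i; under eq_fun do rewrite !mxE; exact: null_mull tf (nu i).
Qed.

Lemma nullv_scale f u : null f -> tamev u -> nullv (fun s => f s *: u s).
Proof.
by move=> nf tu i; under eq_fun do rewrite !mxE; exact: null_mul nf (tu i).
Qed.

Lemma nullv_mulmx A u : nullv u -> nullv (fun s => A *m u s).
Proof.
move=> nu i; under eq_fun do rewrite !mxE.
by apply: null_sum => j; exact: null_mull (tame_cst _) (nu j).
Qed.

Lemma null_dotv u v : nullv u -> tamev v -> null (fun s => dotv (u s) (v s)).
Proof. by move=> nu tv; apply: null_sum => i; exact: null_mul. Qed.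

Lemma nullv_dotv u : null (fun s => dotv (u s) (u s)) -> nullv u.
Proof.
move=> nu i; apply: null_sqr; apply: null_le nu => s.
by rewrite ger0_norm ?sqr_ge0// sqr_coord_le_dotv.
Qed.

Lemma tamevD u v : tamev u -> tamev v -> tamev (fun s => u s + v s).
Proof.
by move=> nu nv i; under eq_fun do rewrite mxE; exact: tameD (nu i) (nv i).
Qed.

Lemma tamevB u v : tamev u -> tamev v -> tamev (fun s => u s - v s).
Proof.
by move=> nu nv i; under eq_fun do rewrite !mxE; exact: tameB (nu i) (nv i).
Qed.

Lemma tamevZ f u : tame f -> tamev u -> tamev (fun s => f s *: u s).
Proof.
by move=> tf nu i; under eq_fun do rewrite !mxE; exact: tameM tf (nu i).
Qed.

Lemma tamev_mulmx A u : tamev u -> tamev (fun s => A *m u s).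
Proof.
move=> nu i; under eq_fun do rewrite !mxE.
by apply: tame_sum => j; exact: tameM (tame_cst _) (nu j).
Qed.

Lemma tame_dotv u v : tamev u -> tamev v -> tame (fun s => dotv (u s) (v s)).
Proof. by move=> nu tv; apply: tame_sum => i; exact: tameM. Qed.

(** The curve [u] has derivative [u'] at every time, coordinate by
    coordinate. *)
Definition vderive u u' := forall (s : R) i,
  is_derive s (1 : R) (fun t => u t i 0) (u' s i 0).

Lemma derive1_vderive u : (forall s, derivable u s 1) ->
  vderive u (derive1 u).
Proof.
move=> du s i; rewrite derive1E derive_mx// mxE.
by apply: derivableP; exact: (derivable_mxP _ _ _).1 (du s) i 0.
Qed.

Lemma vderive_derive1 u u' : vderive u u' ->
  (forall s, derivable u s 1) /\ derive1 u = u'.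
Proof.
move=> du; have Du s : derivable u s 1.
  by apply/derivable_mxP => i j; rewrite ord1; have [] := du s i.
split=> //; apply/funext => s; rewrite derive1E derive_mx//.
by apply/matrixP => i j; rewrite mxE ord1; have [] := du s i.
Qed.

Lemma vderiveB u v u' v' : vderive u u' -> vderive v v' ->
  vderive (fun s => u s - v s) (fun s => u' s - v' s).
Proof.
move=> du dv s i; under eq_fun do rewrite !mxE.
by rewrite !mxE; exact: is_derive_sub.
Qed.

Lemma vderiveZ f (f' : R -> R) u u' :
  (forall s : R, is_derive s (1 : R) f (f' s)) -> vderive u u' ->
  vderive (fun s => f s *: u s) (fun s => f' s *: u s + f s *: u' s).
Proof.
move=> df du s i; under eq_fun do rewrite !mxE.
by rewrite !mxE; exact: is_derive_mul.
Qed.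

Lemma vderive_mulmx A u u' : vderive u u' ->
  vderive (fun s => A *m u s) (fun s => A *m u' s).
Proof.
move=> du s i; under eq_fun do rewrite !mxE.
rewrite !mxE; apply: is_derive_bigsum => j.
by have := is_derive_mul (is_derive_cst (A i j) s (1 : R)) (du s j);
  rewrite mul0r add0r.
Qed.

Lemma is_derive_dotv u v u' v' (s : R) : vderive u u' -> vderive v v' ->
  is_derive s (1 : R) (fun t => dotv (u t) (v t))
    (dotv (u' s) (v s) + dotv (u s) (v' s)).
Proof.
move=> du dv; rewrite /dotv -big_split /=.
by apply: is_derive_bigsum => i; exact: is_derive_mul.
Qed.

End VectorCalculus.

Lemma expRN_mul_le1 {R : realType} (z : R) : expR (- z) * z <= 1.
Proof.
rewrite expRN mulrC ler_pdivrMr ?expR_gt0// mul1r.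
by apply: le_trans (expR_ge1Dx z); rewrite lerDr.
Qed.

Lemma expRN_mul_sqr_le4 {R : realType} (z : R) :
  0 <= z -> expR (- z) * z ^+ 2 <= 4.
Proof.
move=> z0; rewrite expRN mulrC ler_pdivrMr ?expR_gt0//.
have := expR_ge1Dx (z / 2); set e := expR (z / 2) => e1.
have -> : expR z = e * e by rewrite -expRD; congr expR; field.
nra.
Qed.

(** * Asymptotics of a soliton *)

(** The notations stand for: p = <C, T>, lam = <T, A C>, y = |C|^2,
    E = exp(alpha/2 |C|^2), V = E lam, q = |A C|^2 - lam^2 (which is |w|^2 for
    w = A C - lam T), and T' for the right-hand side of the soliton
    equation. *)
Section SolitonDynamics.
Context {R : realType} {n : nat} {alpha : R} {A : 'M[R]_n}.
Context {C T : R -> 'cV[R]_n}.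
Context (alpha_lt0 : alpha < 0) (A_antisym : A^T = - A).

Local Notation p s := (dotv (C s) (T s)).
Local Notation lam s := (dotv (T s) (A *m C s)).
Local Notation y s := (dotv (C s) (C s)).
Local Notation q s := (dotv (A *m C s) (A *m C s) - lam s ^+ 2).
Local Notation E s := (expR (alpha / 2 * y s)).
Local Notation V s := (E s * lam s).
Local Notation T' s := (alpha *: C s + A *m C s - (alpha * p s + lam s) *: T s).

Context (dC : vderive C T) (dT : vderive T (fun s => T' s))
  (T1 : forall s, dotv (T s) (T s) = 1).

Let dAC : vderive (fun s => A *m C s) (fun s => A *m T s).
Proof. exact: vderive_mulmx. Qed.

Let is_derive_lam (s : R) :
  is_derive s (1 : R) (fun t => lam t) (q s - alpha * p s * lam s).
Proof.
have := is_derive_dotv s dT dAC; congr is_derive.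
rewrite dotvBl dotvDl !dotvZl !dotv_skew0//.
ring.
Qed.

Let is_derive_E (s : R) :
  is_derive s (1 : R) (fun t => E t) (alpha * p s * E s).
Proof.
have dy := is_derive_mul (is_derive_cst (alpha / 2) s (1 : R))
  (is_derive_dotv s dC dC).
have dE : is_derive (alpha / 2 * y s) (1 : R) expR (E s).
  exact: is_derive_expR.
have := @is_derive1_comp _ expR (fun t => alpha / 2 * y t) s _ _ dE dy.
congr is_derive; rewrite (dotvC (T s)) mul0r add0r /cst; by field.
Qed.

(* the monotonicity formula V' = E |w|^2 *)
Let is_derive_V (s : R) : is_derive s (1 : R) (fun t => V t) (E s * q s).
Proof.
have := is_derive_mul (is_derive_E s) (is_derive_lam s).
congr is_derive; ring.
Qed.

Let w s := A *m C s - lam s *: T s.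

Let dotv_w s : dotv (w s) (w s) = q s.
Proof.
rewrite /w !dotvBl !dotvBr !dotvZl !dotvZr T1 (dotvC (A *m C s) (T s)); ring.
Qed.

Let q_ge0 s : 0 <= q s.
Proof. by rewrite -dotv_w dotv_ge0. Qed.

Lemma V_nondecreasing s t : s <= t -> V s <= V t.
Proof.
move=> st; have [c _ E] := MVT_is_derive is_derive_V st.
by rewrite -subr_ge0 E mulr_ge0 ?subr_ge0// mulr_ge0 ?expR_ge0//; exact: q_ge0.
Qed.

Let V_sqr_le K (HK : forall u, dotv (A *m u) (A *m u) <= K * dotv u u) s :
  V s ^+ 2 <= expR (alpha * y s) * (K * y s).
Proof.
rewrite exprMn expr2 -expRD -mulrDl -splitr.
by rewrite ler_pM2l ?expR_gt0// (le_trans _ (HK _))// -subr_ge0 q_ge0.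
Qed.

Lemma V_bounded : exists M, forall s, V s <= M.
Proof.
have [K K0 HK] := mulmx_bounded A; exists (1 + K / - alpha) => s.
have Na : 0 < - alpha by rewrite oppr_gt0.
have V2 : V s ^+ 2 <= K / - alpha.
  apply: le_trans (V_sqr_le HK s) _; rewrite ler_pdivlMr//.
  have := expRN_mul_le1 (- alpha * y s); rewrite mulNr opprK => H.
  by have := ler_wpM2l K0 H; lra.
by apply: (@le_trans _ _ (1 + V s ^+ 2)); [nra|rewrite lerD2l].
Qed.

Lemma V_cvg : cvg (V s @[s --> +oo]).
Proof.
apply/cvg_ex; exists (sup (range (fun s => V s))).
apply: nondecreasing_cvgr; first by move=> s t; exact: V_nondecreasing.
by have [M VM] := V_bounded; exists M => _ [s _ <-].
Qed.

Context (Vp : R) (cvgV : V s @[s --> +oo] --> Vp) (Vp_neq0 : Vp != 0).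

(* near infinity |V| is bounded below; y is then bounded above, since
   V^2 <= K y exp(alpha y) *)
Let V_ge : exists c : R, 0 < c /\ \forall s \near +oo, c <= `|V s|.
Proof.
exists (`|Vp| / 2); have Vp2 : 0 < `|Vp| / 2 by rewrite divr_gt0// normr_gt0.
split=> //; have /cvgrPdist_le/(_ _ Vp2) := cvgV; apply: filterS => s H.
have := ler_normD (Vp - V s) (V s); rewrite subrK; lra.
Qed.

Let y_bounded : exists Y : R, \forall s \near +oo, y s <= Y.
Proof.
have [K K0 HK] := mulmx_bounded A; have [c [c0 Vc]] := V_ge.
exists (4 * K / (c ^+ 2 * alpha ^+ 2)); apply: filterS Vc => s Vc.
have a2 : 0 < alpha ^+ 2 by rewrite expr2 nmulr_rgt0.
rewrite ler_pdivlMr; last by rewrite mulr_gt0// exprn_gt0.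
have y0 := dotv_ge0 (C s).
have c2 : c ^+ 2 <= expR (alpha * y s) * (K * y s).
  apply: le_trans (V_sqr_le HK s); rewrite -(real_normK (num_real (V s))).
  by rewrite ler_pXn2r// nnegrE ltW.
have z0 : 0 <= - alpha * y s by rewrite mulr_ge0// oppr_ge0 ltW.
have := expRN_mul_sqr_le4 z0; rewrite mulNr opprK sqrrN exprMn => H.
have := ler_wpM2l K0 H; have := ler_wpM2r (mulr_ge0 y0 (ltW a2)) c2; lra.
Qed.

Let T_le1 s i : `|T s i 0| <= 1.
Proof.
rewrite -(@ler_pXn2r _ 2)// ?nnegrE// expr1n real_normK ?num_real//.
by rewrite -(T1 s) sqr_coord_le_dotv.
Qed.

Let coord_le (u : 'cV[R]_n) (Y : R) i : dotv u u <= Y -> `|u i 0| <= 1 + Y.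
Proof.
move=> uY; have := sqr_coord_le_dotv u i.
rewrite -(real_normK (num_real (u i 0))).
have := normr_ge0 (u i 0); nra.
Qed.

Let tame_C : tamev C.
Proof.
have [Y /near_pinftyP[a yY]] := y_bounded.
move=> i; apply: (tame_derive (M := 1 + Y) (a := a) (fun s => dC s i)) => s sa.
  by apply: coord_le; exact: yY.
apply: le_trans (T_le1 s i) _; rewrite lerDl.
exact: le_trans (dotv_ge0 _) (yY s sa).
Qed.

Let dotv_T' s :
  dotv (T' s) (T' s) <= alpha ^+ 2 * y s + dotv (A *m C s) (A *m C s).
Proof.
have -> : dotv (T' s) (T' s) = alpha ^+ 2 * y s + dotv (A *m C s) (A *m C s)
    - (alpha * p s + lam s) ^+ 2.
  rewrite !(dotvBl, dotvBr, dotvDl, dotvDr, dotvZl, dotvZr) T1 !dotv_skew0//.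
  rewrite (dotvC (A *m C s) (C s)) dotv_skew0// (dotvC (T s) (C s)).
  by rewrite (dotvC (A *m C s) (T s)); ring.
by rewrite gerBl sqr_ge0.
Qed.

Let tame_T : tamev T.
Proof.
have [Y /near_pinftyP[a yY]] := y_bounded; have [K K0 HK] := mulmx_bounded A.
have Y0 : 0 <= Y by apply: le_trans (yY a (lexx a)); exact: dotv_ge0.
move=> i; apply: (tame_derive (M := 1 + (alpha ^+ 2 + K) * Y) (a := a)
  (fun s => dT s i)) => s sa.
  by apply: le_trans (T_le1 s i) _; rewrite lerDl mulr_ge0// addr_ge0// sqr_ge0.
apply: coord_le; apply: le_trans (dotv_T' s) _; rewrite mulrDl lerD//.
  by rewrite ler_wpM2l ?sqr_ge0// yY.
by apply: le_trans (HK _) _; rewrite ler_wpM2l// yY.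
Qed.

Let tame_AC : tamev (fun s => A *m C s).
Proof. exact: tamev_mulmx tame_C. Qed.

Let tame_AT : tamev (fun s => A *m T s).
Proof. exact: tamev_mulmx tame_T. Qed.

Let tame_p : tame (fun s => p s).
Proof. exact: tame_dotv. Qed.

Let tame_lam : tame (fun s => lam s).
Proof. exact: tame_dotv. Qed.

Let tame_q : tame (fun s => q s).
Proof. by apply: tameB; [exact: tame_dotv|exact: tameM]. Qed.

Let tame_T' : tamev (fun s => T' s).
Proof.
apply: tamevB; first by apply: tamevD => //; exact: tamevZ (tame_cst _) tame_C.
by apply: tamevZ => //; apply: tameD => //; exact: tameM (tame_cst _) tame_p.
Qed.

Let alpha2_le0 : alpha / 2 <= 0.
Proof. by rewrite ler_pdivrMr// mul0r ltW. Qed.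

Let E_le1 s : E s <= 1.
Proof.
by rewrite -[leRHS]expR0 ler_expR; exact: mulr_le0_ge0 alpha2_le0 (dotv_ge0 _).
Qed.

Let tame_E : tame (fun s => E s).
Proof.
have [M [a [M0 pM _]]] := tameP (tameM (tame_cst alpha) tame_p).
apply: (tame_derive (M := 1 + M) (a := a) is_derive_E) => s sa.
  by rewrite ger0_norm ?expR_ge0// (le_trans (E_le1 s))// lerDl ltW.
rewrite normrM (ger0_norm (expR_ge0 _)) -[leRHS]mulr1.
by rewrite ler_pM ?expR_ge0// (le_trans (pM s sa))// lerDr.
Qed.

Let E_ge : exists c : R, 0 < c /\ \forall s \near +oo, c <= `|E s|.
Proof.
have [Y yY] := y_bounded; exists (expR (alpha / 2 * Y)); split.
  exact: expR_gt0.
apply: filterS yY => s yY; rewrite ger0_norm ?expR_ge0// ler_expR.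
by rewrite ler_wnM2l.
Qed.

Let lam_ge : exists c : R, 0 < c /\ \forall s \near +oo, c <= `|lam s|.
Proof.
have [c [c0 Vc]] := V_ge; exists c; split=> //; apply: filterS Vc => s.
move/le_trans; apply; rewrite normrM (ger0_norm (expR_ge0 _)) ler_piMl//.
Qed.

(* Barbalat's lemma for V *)
Let null_q : null (fun s => q s).
Proof.
have [c [c0 Ec]] := E_ge; apply: (null_cancel c0 Ec).
by apply: (barbalat is_derive_V cvgV); exact: tameM.
Qed.

Let nullv_w : nullv w.
Proof. by apply: nullv_dotv; apply: eq_null null_q => s; rewrite dotv_w. Qed.

(* lam p = - <C, w>, because <C, A C> = 0 *)
Let null_p : null (fun s => p s).
Proof.
have [c [c0 lamc]] := lam_ge; apply: (null_cancel c0 lamc).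
apply: eq_null (nullN (null_dotv nullv_w tame_C)) => s.
by rewrite /w dotvBl dotvZl dotv_skew// dotv_skew0// (dotvC (T s) (C s)); ring.
Qed.

(** The acceleration is asymptotically the central force alpha C. *)
Lemma nullv_acceleration : nullv (fun s => T' s - alpha *: C s).
Proof.
apply: eq_nullv (nullvB nullv_w (nullv_scale
  (null_mull (tame_cst alpha) null_p) tame_T)) => s.
by rewrite /w scalerDl; apply/colP => i; rewrite !mxE; ring.
Qed.

Let null_lam' : null (fun s => q s - alpha * p s * lam s).
Proof.
apply: nullB => //; apply: null_mul => //.
exact: null_mull (tame_cst alpha) null_p.
Qed.

Let dw : vderive w (fun s =>
  A *m T s - ((q s - alpha * p s * lam s) *: T s + lam s *: T' s)).
Proof. exact: vderiveB dAC (vderiveZ is_derive_lam dT). Qed.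

(* Barbalat's lemma for the coordinates of w *)
Let nullv_w' : nullv (fun s =>
  A *m T s - ((q s - alpha * p s * lam s) *: T s + lam s *: T' s)).
Proof.
move=> i; apply: (barbalat (fun s => dw s i) (nullv_w i)).
apply: tamevB => //; apply: tamevD; apply: tamevZ => //.
by apply: tameB => //; apply: tameM => //; exact: tameM (tame_cst _) tame_p.
Qed.

Let nullv_AT : nullv (fun s => A *m T s - (alpha * lam s) *: C s).
Proof.
apply: eq_nullv (nullvD nullv_w' (nullvD (nullv_scale null_lam' tame_T)
  (nullvZ tame_lam nullv_acceleration))) => s.
by apply/colP => i; rewrite !mxE; ring.
Qed.

Let nullv_AAC :
  nullv (fun s => A *m (A *m C s) - (alpha * lam s ^+ 2) *: C s).
Proof.
apply: eq_nullv (nullvD (nullv_mulmx A nullv_w)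
  (nullvZ tame_lam nullv_AT)) => s.
rewrite /w mulmxBr -scalemxAr.
by apply/colP => i; rewrite !mxE; ring.
Qed.

(** Pairing A^2 C - alpha lam^2 C -> 0 with C gives
    lam^2 (1 + alpha |C|^2) -> 0. *)
Lemma sqnorm_cvg : y s @[s --> +oo] --> - alpha^-1.
Proof.
have [c [c0 lamc]] := lam_ge.
have H : null (fun s => - (1 + alpha * y s)).
  (* cancel the factor lam twice *)
  apply: (null_cancel c0 lamc); apply: (null_cancel c0 lamc).
  apply: eq_null (nullD (null_dotv nullv_AAC tame_C) null_q) => s.
  rewrite dotvBl dotvZl dotv_skew//; ring.
have /nullN := null_mull (tame_cst alpha^-1) H.
rewrite -[- alpha^-1]sub0r => /cvgB/(_ (cvg_cst alpha^-1)).
apply: eq_cvg_pinfty => s /=.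
by rewrite -[(- cst _) s]/(- alpha^-1); field; exact: ltr0_neq0.
Qed.

Let L : R := Vp * expR (1 / 2).

Lemma lam_cvg : lam s @[s --> +oo] --> L.
Proof.
have EN : expR (- (alpha / 2 * y s)) @[s --> +oo] --> expR (1 / 2).
  have -> : 1 / 2 = - (alpha / 2 * - alpha^-1) by field; exact: ltr0_neq0.
  apply: continuous_cvg; first exact: continuous_expR.
  by apply: cvgN; apply: cvgM sqnorm_cvg; exact: cvg_cst.
apply: eq_cvg_pinfty (cvgM cvgV EN) => s /=.
by rewrite mulrAC -expRD subrr expR0 mul1r.
Qed.

Let null_lam : null (fun s => lam s - L).
Proof.
by rewrite /null -(subrr L); exact: cvgB lam_cvg (cvg_cst L).
Qed.

Lemma nullv_velocity : nullv (fun s => A *m C s - L *: T s).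
Proof.
apply: eq_nullv (nullvD nullv_w (nullv_scale null_lam tame_T)) => s.
by apply/colP => i; rewrite !mxE; ring.
Qed.

Lemma nullv_eigen : nullv (fun s => A *m (A *m C s) - (alpha * L ^+ 2) *: C s).
Proof.
have H : null (fun s => alpha * (lam s + L) * (lam s - L)).
  apply: null_mull null_lam; apply: tameM (tame_cst _) _.
  exact: tameD tame_lam (tame_cst _).
apply: eq_nullv (nullvD nullv_AAC (nullv_scale H tame_C)) => s.
by apply/colP => i; rewrite !mxE; ring.
Qed.

End SolitonDynamics.

(** * Omega-limit sets and subfilters *)

Section OmegaLimit.
Context {R : realType} {T : topologicalType}.
Implicit Types (X : R -> T) (F G : set_system R).

(** A cluster point of [X] along [F] is a limit of [X] along a finer filter. *)
Lemma cluster_subfilter X F x : ProperFilter F -> cluster (X @ F) x ->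
  exists G, [/\ ProperFilter G, F `<=` G & X @ G --> x].
Proof.
move=> FF clx.
exists (filter_from [set AB : set R * set T | F AB.1 /\ nbhs x AB.2]
  (fun AB => AB.1 `&` X @^-1` AB.2)); split.
- apply: filter_from_proper => [|[A B] [/= FA xB]].
    apply: filter_from_filter => [|[A B] [A' B'] [/= FA xB] [/= FA' xB']].
      by exists (setT, setT); split; exact: filterT.
    exists (A `&` A', B `&` B'); first by split; exact: filterI.
    by move=> s [[As A's] [Bs B's]].
  have [_ [[s As <-] Bs]] : (X @` A) `&` B !=set0.
    apply: (clx (X @` A) B _ xB).
    by rewrite /fmap /=; apply: (filterS _ FA) => s As; exists s.
  by exists s.
- by move=> A FA; exists (A, setT); [split=> //; exact: filterT|move=> s []].
- by move=> B xB; exists (setT, B); [split=> //; exact: filterT|move=> s []].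
Qed.

Lemma omega_limit_cluster X : omega_limit X = cluster (X @ +oo).
Proof.
apply/seteqP; split=> x.
  move=> Xx A B /near_pinftyP[a aA] xB.
  have [|_ [[s /= sa <-] Bs]] := Xx (`|a| + 1) _ B xB.
    by rewrite /= ltr_pwDr.
  exists (X s); split=> //; apply: aA; apply: le_trans sa.
  by rewrite (le_trans (ler_norm a))// lerDl.
move=> clx a /= a0 B xB; apply: clx xB.
by apply/near_pinftyP; exists a => s sa; exists s.
Qed.

(** Omega-limit points are the limits of the curve along the proper filters of
    times that go to infinity. *)
Lemma omega_limitP X x : omega_limit X x <->
  exists G, [/\ ProperFilter G, +oo `<=` G & X @ G --> x].
Proof.
rewrite omega_limit_cluster; split; first exact: cluster_subfilter.
move=> [G [GG ooG Gx]] A B ooA xB.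
have : G (X @^-1` (A `&` B)).
  by rewrite preimage_setI; apply: filterI; [exact: ooG|exact: Gx].
by move=> /filter_ex[s XsAB]; exists (X s).
Qed.

(** A curve in a compact set converges along some refinement of any proper
    filter of times. *)
Lemma compact_subfilter X F (K : set T) : ProperFilter F -> compact K ->
  (forall s, K (X s)) ->
  exists (x : T) G, [/\ ProperFilter G, F `<=` G & X @ G --> x].
Proof.
move=> FF cK KX; have [|x [_ /cluster_subfilter[G HG]]] := cK (X @ F).
  have XK : X @^-1` K = setT by apply/seteqP; split=> // s _; exact: KX.
  by rewrite /fmap /= XK; exact: filterT.
by exists x, G.
Qed.

End OmegaLimit.

Section VectorLimits.
Context {R : realType} {n : nat} {G : set_system R}.
Implicit Types (u v : R -> 'cV[R]_n) (a b : 'cV[R]_n).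

(** Coordinatewise convergence of [u] to [a] along the filter [G] of times. *)
Definition cvgv u a := forall i, u s i 0 @[s --> G] --> a i 0.

Lemma cvgvE {FG : Filter G} u a : cvgv u a <-> u @ G --> a.
Proof.
split=> [ua A [P aP sPA]|ua i].
  apply: filterS (sPA) _; apply: filter_forall => i; apply: filter_forall => j.
  by rewrite ord1; exact: ua (aP i 0).
exact: (cvg_comp _ _ ua (@coord_continuous _ _ _ i 0 a)).
Qed.

Lemma eq_cvgv u v a : cvgv u a -> u =1 v -> cvgv v a.
Proof. by move=> + /funext <-. Qed.

Lemma cvgvD {FG : Filter G} u v a b : cvgv u a -> cvgv v b ->
  cvgv (fun s => u s + v s) (a + b).
Proof.
move=> ua vb i; under eq_fun do rewrite mxE; rewrite mxE.
exact: cvgD (ua i) (vb i).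
Qed.

Lemma cvgvZ {FG : Filter G} (f : R -> R) (k : R) u a :
  f @ G --> k -> cvgv u a -> cvgv (fun s => f s *: u s) (k *: a).
Proof.
move=> fk ua i; under eq_fun do rewrite mxE; rewrite mxE.
exact: cvgM fk (ua i).
Qed.

Lemma cvg_bigsum {FG : Filter G} m (h : 'I_m -> R -> R) (l : 'I_m -> R) :
  (forall i, h i @ G --> l i) -> (\sum_i h i s) @[s --> G] --> \sum_i l i.
Proof.
elim: m h l => [|m IH] h l hl.
  by under eq_fun do rewrite big_ord0; rewrite big_ord0; exact: cvg_cst.
under eq_fun do rewrite big_ord_recr; rewrite big_ord_recr.
by apply: cvgD (hl _); exact: IH.
Qed.

Lemma cvgv_mulmx {FG : Filter G} (A : 'M[R]_n) u a : cvgv u a ->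
  cvgv (fun s => A *m u s) (A *m a).
Proof.
move=> ua i; under eq_fun do rewrite mxE; rewrite mxE.
by apply: cvg_bigsum => j; apply: cvgM (ua j); exact: cvg_cst.
Qed.

Lemma cvg_dotv {FG : Filter G} u v a b : cvgv u a -> cvgv v b ->
  dotv (u s) (v s) @[s --> G] --> dotv a b.
Proof. by move=> ua vb; apply: cvg_bigsum => i; exact: cvgM (ua i) (vb i). Qed.

Lemma cvgv_unique {FG : ProperFilter G} u a b : cvgv u a -> cvgv u b -> a = b.
Proof.
move=> ua ub; apply/colP => i.
exact: (@cvg_unique _ (@norm_hausdorff _ R^o) _ _ _ _ (ua i) (ub i)).
Qed.

Lemma nullv_cvgv u : +oo `<=` G -> nullv u -> cvgv u 0.
Proof. by move=> ooG nu i; rewrite mxE => A /(nu i); exact: ooG. Qed.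

Lemma nullv_sub_cvgv {FG : Filter G} u v a : +oo `<=` G ->
  nullv (fun s => u s - v s) -> cvgv v a -> cvgv u a.
Proof.
move=> ooG nuv va; rewrite -[a]add0r.
by apply: eq_cvgv (cvgvD (nullv_cvgv ooG nuv) va) _ => s; rewrite subrK.
Qed.

End VectorLimits.
Arguments cvgv {R n} G u a.

Lemma compact_cube {R : realType} (n : nat) :
  compact [set v : 'cV[R]_n | forall i, `|v i 0| <= 1].
Proof.
have cI : compact [set v : 'rV[R]_n | forall i, v ord0 i \in `[(-1 : R), 1]].
  apply: (@rV_compact _  _ (fun=> `[(-1 : R), 1]%classic)).
  by move=> _; exact: segment_compact.
rewrite (_ : mkset _ = trmx @` [set v : 'rV[R]_n |
    forall i, v ord0 i \in `[(-1 : R), 1]]).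
  apply: continuous_compact cI; apply: continuous_subspaceT => v A [P vP sPA].
  exists (fun i j => P j i) => [i j|M PM].
    by have := vP j i; rewrite mxE.
  by apply: sPA => i j; rewrite mxE; exact: PM.
apply/seteqP; split=> v /=.
  move=> v1; exists v^T; last exact: trmxK.
  by move=> i; rewrite mxE in_itv /= -ler_norml.
by move=> [u u1 <-] i; have := u1 i; rewrite mxE in_itv /= -ler_norml.
Qed.

(** * Asymptotically harmonic motion *)

Section Rotation.
Context {R : realType}.
Implicit Types (f : R -> R).

Lemma is_derive_cos_lin (w s : R) :
  is_derive s (1 : R) (fun t => cos (w * t)) (- (w * sin (w * s))).
Proof.
have dw : is_derive s (1 : R) ( *%R w) w.
  by have := is_derive_mul (is_derive_cst w s (1 : R)) (is_derive_id s (1 : R));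
    rewrite mul0r add0r /cst mulr1.
have dE : is_derive (w * s) (1 : R) cos (- sin (w * s)) by exact: is_derive_cos.
by have := @is_derive1_comp _ cos ( *%R w) s _ _ dE dw; congr is_derive; ring.
Qed.

Lemma is_derive_sin_lin (w s : R) :
  is_derive s (1 : R) (fun t => sin (w * t)) (w * cos (w * s)).
Proof.
have dw : is_derive s (1 : R) ( *%R w) w.
  by have := is_derive_mul (is_derive_cst w s (1 : R)) (is_derive_id s (1 : R));
    rewrite mul0r add0r /cst mulr1.
have dE : is_derive (w * s) (1 : R) sin (cos (w * s)) by exact: is_derive_sin.
by have := @is_derive1_comp _ sin ( *%R w) s _ _ dE dw; congr is_derive; ring.
Qed.

(** If the acceleration is asymptotically the central force - w^2 c, then the
    flow of the harmonic oscillator predicts c and c' up to an error that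
    vanishes at infinity, for every fixed time lag. *)
Lemma null_rotation (w tau : R) (c c' c'' : R -> R) : w != 0 ->
  (forall s : R, is_derive s (1 : R) c (c' s)) ->
  (forall s : R, is_derive s (1 : R) c' (c'' s)) ->
  null (fun s => c'' s + w ^+ 2 * c s) ->
  null (fun s => c (s + tau) - (cos (w * tau) * c s + sin (w * tau) / w * c' s))
  /\ null (fun s =>
       c' (s + tau) - (- w * sin (w * tau) * c s + cos (w * tau) * c' s)).
Proof.
move=> w0 dc dc' na.
have bcos (k b : R) : \forall s \near +oo, `|k * cos (w * (s + b))| <= `|k|.
  apply/near_pinftyP; exists 0 => s _; rewrite normrM ler_piMr//.
  by rewrite ler_norml cos_le1 cos_geN1.
have bsin (k b : R) : \forall s \near +oo, `|k * sin (w * (s + b))| <= `|k|.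
  apply/near_pinftyP; exists 0 => s _; rewrite normrM ler_piMr//.
  by rewrite ler_norml sin_le1 sin_geN1.
(* f1 and f2 are the position and velocity carried back to time 0 by the
   oscillator *)
pose f1 s := cos (w * s) * c s - w^-1 * (sin (w * s) * c' s).
pose f2 s := w * (sin (w * s) * c s) + cos (w * s) * c' s.
have df1 (s : R) : is_derive s (1 : R) f1
    ((c'' s + w ^+ 2 * c s) * (- w^-1 * sin (w * (s + 0)))).
  have := is_derive_sub (is_derive_mul (is_derive_cos_lin w s) (dc s))
    (is_derive_mul (is_derive_cst w^-1 s (1 : R))
       (is_derive_mul (is_derive_sin_lin w s) (dc' s))).
  by congr is_derive; rewrite /cst addr0; field.
have df2 (s : R) : is_derive s (1 : R) f2
    ((c'' s + w ^+ 2 * c s) * (1 * cos (w * (s + 0)))).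
  have := is_derive_add (is_derive_mul (is_derive_cst w s (1 : R))
    (is_derive_mul (is_derive_sin_lin w s) (dc s)))
    (is_derive_mul (is_derive_cos_lin w s) (dc' s)).
  by congr is_derive; rewrite /cst addr0; ring.
have n1 := null_shift tau df1 (null_mul_bounded (bsin _ _) na).
have n2 := null_shift tau df2 (null_mul_bounded (bcos _ _) na).
have cE s : c s = cos (w * s) * f1 s + w^-1 * sin (w * s) * f2 s.
  have := cos2Dsin2 (w * s); rewrite /f1 /f2.
  set C := cos _; set S := sin _ => CS.
  transitivity ((C ^+ 2 + S ^+ 2) * c s); first by rewrite CS mul1r.
  by field.
have c'E s : c' s = - w * sin (w * s) * f1 s + cos (w * s) * f2 s.
  have := cos2Dsin2 (w * s); rewrite /f1 /f2.
  set C := cos _; set S := sin _ => CS.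
  transitivity ((C ^+ 2 + S ^+ 2) * c' s); first by rewrite CS mul1r.
  by field.
split.
- have := nullD (null_mul_bounded (bcos 1 tau) n1)
    (null_mul_bounded (bsin w^-1 tau) n2).
  apply: eq_null => s; rewrite (cE (s + tau)) (cE s) (c'E s).
  by rewrite mulrDr cosD sinD; field.
- have := nullD (null_mul_bounded (bsin (- w) tau) n1)
    (null_mul_bounded (bcos 1 tau) n2).
  apply: eq_null => s; rewrite (c'E (s + tau)) (cE s) (c'E s).
  by rewrite mulrDr cosD sinD; field.
Qed.

Lemma cos_sin_onto (a b : R) : a ^+ 2 + b ^+ 2 = 1 ->
  exists t, cos t = a /\ sin t = b.
Proof.
move=> ab; have a1 : -1 <= a <= 1 by apply/andP; split; nra.
have sE : sin (acos a) = `|b|.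
  by rewrite sin_acos// -sqrtr_sqr; congr Num.sqrt; lra.
have [b0|b0] := leP 0 b.
  by exists (acos a); rewrite sE acosK ?in_itv//= ger0_norm.
exists (- acos a); rewrite cosN sinN sE acosK ?in_itv//=.
by rewrite ltr0_norm// opprK.
Qed.

End Rotation.

(** * Limit states and their circles *)

Section LimitCircle.
Context {R : realType} {n : nat}.
Implicit Types (A : 'M[R]_n) (x t : 'cV[R]_n) (alpha L w Omega tau : R).

(** For nonzero w, the solution of c'' = - w^2 c with c(0) = x and
    c'(0) = t. *)
Definition osc w x t tau : 'cV[R]_n :=
  cos (w * tau) *: x + (sin (w * tau) / w) *: t.

(** The derivative of [osc w x t], for nonzero w. *)
Definition osc' w x t tau : 'cV[R]_n :=
  (- w * sin (w * tau)) *: x + cos (w * tau) *: t.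

Lemma vderive_osc w x t : w != 0 -> vderive (osc w x t) (osc' w x t).
Proof.
move=> w0 s i; under eq_fun do rewrite !mxE.
have := is_derive_add
  (is_derive_mul (is_derive_cos_lin w s) (is_derive_cst (x i 0) s (1 : R)))
  (is_derive_mul (is_derive_mul (is_derive_sin_lin w s)
    (is_derive_cst w^-1 s (1 : R))) (is_derive_cst (t i 0) s (1 : R))).
congr is_derive; rewrite /cst !mxE; field; exact: w0.
Qed.

Lemma osc0 w x t : osc w x t 0 = x.
Proof. by rewrite /osc mulr0 cos0 sin0 mul0r scale1r scale0r addr0. Qed.

Lemma osc'0 w x t : osc' w x t 0 = t.
Proof. by rewrite /osc' mulr0 cos0 sin0 mulr0 scale0r scale1r add0r. Qed.

(** The relations that hold in the limit between the position [x] and the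
    velocity [t] of a soliton with V_+ <> 0, where [L] is the limit of
    <T, A C>. *)
Definition limit_state alpha A L x t : Prop :=
  [/\ dotv t t = 1, dotv x x = - alpha^-1, A *m x = L *: t &
      A *m (A *m x) = (alpha * L ^+ 2) *: x].

Section LimitState.
Context (alpha : R) (A : 'M[R]_n) (L : R) (x t : 'cV[R]_n).
Context (alpha_lt0 : alpha < 0) (A_antisym : A^T = - A) (L_neq0 : L != 0)
  (xt : limit_state alpha A L x t).

Let w := Num.sqrt (- alpha).

Let w_gt0 : 0 < w.
Proof. by rewrite sqrtr_gt0 oppr_gt0. Qed.

Let w_sqr : w ^+ 2 = - alpha.
Proof. by rewrite sqr_sqrtr// oppr_ge0 ltW. Qed.

Let w_neq0 : w != 0. Proof. exact: lt0r_neq0. Qed.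

Let dotv_xt : dotv x t = 0.
Proof.
have [_ _ Ax _] := xt; apply/eqP; rewrite -(mulrI_eq0 _ (mulfI L_neq0)).
by rewrite -dotvZr -Ax dotv_skew0.
Qed.

Let dotv_xx : dotv x x = w ^- 2.
Proof. by have [_ -> _ _] := xt; rewrite w_sqr invrN. Qed.

Lemma dotv_osc tau : dotv (osc w x t tau) (osc w x t tau) = - alpha^-1.
Proof.
have [tt xx _ _] := xt.
rewrite !(dotvDl, dotvDr, dotvZl, dotvZr) (dotvC t x) dotv_xt tt dotv_xx.
rewrite -invrN -w_sqr.
transitivity ((cos (w * tau) ^+ 2 + sin (w * tau) ^+ 2) * w ^- 2).
  by field.
by rewrite cos2Dsin2 mul1r.
Qed.

Lemma dotv_osc' tau : dotv (osc' w x t tau) (osc' w x t tau) = 1.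
Proof.
have [tt xx _ _] := xt.
rewrite !(dotvDl, dotvDr, dotvZl, dotvZr) (dotvC t x) dotv_xt tt dotv_xx.
by rewrite -[RHS](cos2Dsin2 (w * tau)); field.
Qed.

Lemma soliton_radius_sqr : soliton_radius alpha ^+ 2 = - alpha^-1.
Proof. by rewrite /soliton_radius exprVn w_sqr invrN. Qed.

Lemma arclength_osc : arclength_param (osc w x t).
Proof.
have [D D'] := vderive_derive1 (vderive_osc x t w_neq0).
by move=> s; split; [exact: D|rewrite D' /enorm dotv_osc' sqrtr1].
Qed.

Context (Omega : R) (Omega_gt0 : 0 < Omega)
  (Omega_sqr : Omega ^+ 2 = - alpha * L ^+ 2).

Lemma limit_state_freq_space : x \in freq_space A Omega.
Proof.
have [_ _ _ AAx] := xt; apply/freq_spaceP.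
by rewrite AAx Omega_sqr mulNr opprK.
Qed.

Lemma limit_state_neq0 : x != 0.
Proof.
by rewrite -dotv_eq0 dotv_xx invr_eq0 sqrf_eq0.
Qed.

Lemma enormP (y : 'cV[R]_n) :
  enorm y = soliton_radius alpha <-> dotv y y = - alpha^-1.
Proof.
rewrite -soliton_radius_sqr -enorm_sqr; split=> [->//|/eqP].
rewrite eqrXn2 ?sqrtr_ge0// ?invr_ge0 ?ltW//.
by move/eqP.
Qed.

(** The oscillator issued from a limit state runs through the complex circle
    of [x]: A x = L t, so the plane of the circle is spanned by x and t. *)
Lemma range_osc : range (osc w x t) =
  [set y | y \in <<[:: x; Omega^-1 *: (A *m x)]>>%VS /\
           enorm y = soliton_radius alpha].
Proof.
have [tt xx Ax _] := xt; rewrite Ax scalerA.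
have O0 : Omega != 0 by exact: lt0r_neq0.
have k1 : (w * (Omega^-1 * L)) ^+ 2 = 1.
  rewrite exprMn exprMn exprVn w_sqr Omega_sqr; field.
  by rewrite L_neq0 lt_eqF.
set k := Omega^-1 * L in k1 *.
have k0 : k != 0 by rewrite mulf_neq0// invr_eq0.
apply/seteqP; split=> [y /= [tau _ <-]|y /= [yS /enormP yr]].
  split; last exact/enormP/dotv_osc.
  rewrite /osc span_cons span_seq1 memv_add//.
    by rewrite memvZ// memv_line.
  have -> : (sin (w * tau) / w) *: t = (sin (w * tau) / w / k) *: (k *: t).
    by rewrite scalerA divfK.
  by rewrite memvZ// memv_line.
move: yS; rewrite span_cons span_seq1.
move=> /memv_addP[_ /vlineP[a ->] [_ /vlineP[b ->] yE]].
have ab : a ^+ 2 + (b * (w * k)) ^+ 2 = 1.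
  have := yr; rewrite yE !(dotvDl, dotvDr, dotvZl, dotvZr) (dotvC t x).
  rewrite dotv_xt tt dotv_xx -invrN -w_sqr => /(congr1 ( *%R (w ^+ 2))).
  rewrite divff ?sqrf_eq0// => <-.
  by field.
(* (a, b w k) are the cosine and sine of the phase, as w k = 1 or - 1 *)
have [tau [ca sb]] := cos_sin_onto ab.
exists (tau / w) => //; rewrite /osc mulrCA divff// mulr1 ca sb yE scalerA.
by congr (_ + _ *: _); field.
Qed.

End LimitState.

End LimitCircle.

(** * The omega-limit set of a soliton *)

(** The soliton equation with its projection expanded, since |T| = 1. *)
Lemma soliton_vderive {R : realType} {n : nat} (alpha : R) (A : 'M[R]_n)
    (C : R -> 'cV[R]_n) (T := derive1 C) :
  soliton alpha A C ->
  [/\ vderive C T,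
      vderive T (fun s => alpha *: C s + A *m C s
        - (alpha * dotv (C s) (T s) + dotv (T s) (A *m C s)) *: T s) &
      forall s, dotv (T s) (T s) = 1].
Proof.
move=> [arc sol].
have T1 s : dotv (T s) (T s) = 1.
  by have [_ e1] := arc s; rewrite -enorm_sqr e1 expr1n.
split=> //; first by apply: derive1_vderive => s; have [] := arc s.
move=> s i; have dT : vderive T (derive1 T).
  by apply: derive1_vderive => r; have [] := sol r.
have [_ T'E] := sol s; have [_ e1] := arc s.
have := dT s i; congr is_derive; rewrite T'E /proj_orth e1 expr1n divr1.
rewrite mulmxDl mul_scalar_mx dotvDl dotvZl (dotvC (A *m C s)); congr (_ _ _).
Qed.

Lemma orbit_PT_in_cube {R : realType} {n : nat} (C : R -> 'cV[R]_n) :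
  arclength_param C -> forall s,
  ([set v : 'cV[R]_n | forall i, `|v i 0| <= 1] `*`
   [set v : 'cV[R]_n | forall i, `|v i 0| <= 1]) (orbit_PT C s).
Proof.
have le1 (u : 'cV[R]_n) i : dotv u u <= 1 -> `|u i 0| <= 1.
  move=> u1; rewrite -(@ler_pXn2r _ 2)// ?nnegrE// expr1n.
  rewrite real_normK ?num_real//.
  exact: le_trans (sqr_coord_le_dotv _ _) u1.
move=> arc s; split=> i /=; apply: le1; last first.
  by have [_ e1] := arc s; rewrite -enorm_sqr e1 expr1n.
have h := dotv_ge0 (C s).
rewrite dotvZl dotvZr mulrA -expr2 exprVn enorm_sqr sqr_sqrtr ?addr_ge0//.
by rewrite mulrC ler_pdivrMr ?mul1r ?lerDr// ltr_pwDl.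
Qed.

Section NonzeroLimit.
Context {R : realType} {n : nat} (alpha : R) (A : 'M[R]_n) (C : R -> 'cV[R]_n).
Context (alpha_lt0 : alpha < 0) (A_antisym : A^T = - A)
  (C_soliton : soliton alpha A C) (V_neq0 : Vplus alpha A C != 0).

Let T := derive1 C.
Let L := Vplus alpha A C * expR (1 / 2).
Let w := Num.sqrt (- alpha).

Let w_gt0 : 0 < w.
Proof. by rewrite sqrtr_gt0 oppr_gt0. Qed.

Let w_sqr : w ^+ 2 = - alpha.
Proof. by rewrite sqr_sqrtr// oppr_ge0 ltW. Qed.

Let arc : arclength_param C.
Proof. by case: C_soliton. Qed.

Let dC : vderive C T.
Proof. by have [] := soliton_vderive C_soliton. Qed.

Let dT : vderive T (fun s => alpha *: C s + A *m C s
        - (alpha * dotv (C s) (T s) + dotv (T s) (A *m C s)) *: T s).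
Proof. by have [] := soliton_vderive C_soliton. Qed.

Let T1 s : dotv (T s) (T s) = 1.
Proof. by have [_ _] := soliton_vderive C_soliton; apply. Qed.

Let cvg_Vplus : expR (alpha / 2 * dotv (C s) (C s)) * dotv (T s) (A *m C s)
  @[s --> +oo] --> Vplus alpha A C.
Proof.
have := V_cvg alpha_lt0 A_antisym dC dT T1.
rewrite /Vplus; suff -> : (fun s => Vfun alpha A (C s) (derive1 C s)) =
  (fun s => expR (alpha / 2 * dotv (C s) (C s)) * dotv (T s) (A *m C s)) by [].
by apply/funext => s; rewrite /Vfun enorm_sqr.
Qed.

Let velocity := nullv_velocity alpha_lt0 A_antisym dC dT T1 cvg_Vplus V_neq0.
Let eigen := nullv_eigen alpha_lt0 A_antisym dC dT T1 cvg_Vplus V_neq0.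
Let acceleration :=
  nullv_acceleration alpha_lt0 A_antisym dC dT T1 cvg_Vplus V_neq0.
Let radius := sqnorm_cvg alpha_lt0 A_antisym dC dT T1 cvg_Vplus V_neq0.

(** Every limit of (P, T) along times going to infinity comes from a limit
    state; |C| converges, so the position is recovered from P. *)
Lemma limit_state_of_filter (G : set_system R) (P0 T0 : 'cV[R]_n) :
  ProperFilter G -> +oo `<=` G -> orbit_PT C @ G --> (P0, T0) ->
  exists x, [/\ cvgv G C x, cvgv G T T0, P0 = ball_map x &
                limit_state alpha A L x T0].
Proof.
move=> GG ooG cX.
have cP : cvgv G (fun s => ball_map (C s)) P0.
  by apply/cvgvE; exact: (cvg_comp _ _ cX cvg_fst).
have cT : cvgv G T T0 by apply/cvgvE; exact: (cvg_comp _ _ cX cvg_snd).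
have cy : dotv (C s) (C s) @[s --> G] --> - alpha^-1.
  by move=> B /radius; exact: ooG.
have ck : Num.sqrt (1 + enorm (C s) ^+ 2) @[s --> G] -->
    Num.sqrt (1 + - alpha^-1).
  under eq_fun do rewrite enorm_sqr.
  by apply: continuous_cvg; [exact: sqrt_continuous|
    apply: cvgD cy; exact: cvg_cst].
have kgt0 (u : 'cV[R]_n) : 0 < Num.sqrt (1 + enorm u ^+ 2).
  by rewrite sqrtr_gt0 ltr_pwDl// sqr_ge0.
have cC : cvgv G C (Num.sqrt (1 + - alpha^-1) *: P0).
  apply: eq_cvgv (cvgvZ ck cP) _ => s.
  by rewrite /ball_map scalerA divff ?scale1r// lt0r_neq0.
exists (Num.sqrt (1 + - alpha^-1) *: P0); set x := _ *: P0 in cC *.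
have xx : dotv x x = - alpha^-1.
  exact: (@cvg_unique _ (@norm_hausdorff _ R^o) _ _ _ _ (cvg_dotv cC cC) cy).
split=> //.
  rewrite /ball_map enorm_sqr xx scalerA mulVf ?scale1r// lt0r_neq0//.
  by rewrite -xx -enorm_sqr.
split=> //.
- have c1 : dotv (T s) (T s) @[s --> G] --> (1 : R).
    by rewrite (_ : (fun s => _) = cst 1); [exact: cvg_cst|apply/funext].
  exact: (@cvg_unique _ (@norm_hausdorff _ R^o) _ _ _ _ (cvg_dotv cT cT) c1).
- apply: (@cvgv_unique _ _ G _ (fun s => A *m C s)); first exact: cvgv_mulmx.
  by apply: (nullv_sub_cvgv ooG velocity); apply: cvgvZ cT; exact: cvg_cst.
- apply: (@cvgv_unique _ _ G _ (fun s => A *m (A *m C s))).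
    by do 2!apply: cvgv_mulmx.
  by apply: (nullv_sub_cvgv ooG eigen); apply: cvgvZ cC; exact: cvg_cst.
Qed.

Let L_neq0 : L != 0.
Proof. by rewrite mulf_neq0// lt0r_neq0// expR_gt0. Qed.

Let rotation tau i := null_rotation tau (lt0r_neq0 w_gt0) (fun s => dC s i)
  (fun s => dT s i).

(** The omega-limit set contains the whole orbit of the oscillator issued from
    any of its points: shift the filter of times by tau. *)
Lemma orbit_osc_in_omega_limit (G : set_system R) (x T0 : 'cV[R]_n) :
  ProperFilter G -> +oo `<=` G -> cvgv G C x -> cvgv G T T0 ->
  limit_state alpha A L x T0 ->
  range (orbit_PT (osc w x T0)) `<=` omega_limit (orbit_PT C).
Proof.
move=> GG ooG cC cT xT _ [tau _ <-].
have w0 := lt0r_neq0 w_gt0.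
have acc i : null (fun s => (alpha *: C s + A *m C s
    - (alpha * dotv (C s) (T s) + dotv (T s) (A *m C s)) *: T s) i 0
    + w ^+ 2 * C s i 0).
  by apply: eq_null (acceleration i) => s; rewrite w_sqr !mxE; ring.
have cCt : cvgv G (fun s => C (s + tau)) (osc w x T0 tau).
  apply: (@nullv_sub_cvgv _ _ _ _ _
    (fun s => cos (w * tau) *: C s + (sin (w * tau) / w) *: T s) _ ooG).
    move=> i; have [+ _] := rotation tau (acc i); apply: eq_null => s.
    by rewrite !mxE.
  by apply: cvgvD; apply: cvgvZ => //; exact: cvg_cst.
have cTt : cvgv G (fun s => T (s + tau)) (osc' w x T0 tau).
  apply: (@nullv_sub_cvgv _ _ _ _ _
    (fun s => (- w * sin (w * tau)) *: C s + cos (w * tau) *: T s) _ ooG).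
    move=> i; have [_ +] := rotation tau (acc i); apply: eq_null => s.
    by rewrite !mxE.
  by apply: cvgvD; apply: cvgvZ => //; exact: cvg_cst.
apply/omega_limitP; exists ((fun s => s + tau) @ G); split.
- exact: fmap_proper_filter.
- move=> B /near_pinftyP[a aB]; apply: ooG; apply/near_pinftyP.
  by exists (a - tau) => s; rewrite lerBlDr; exact: aB.
have [_ D'] := vderive_derive1 (vderive_osc x T0 w0).
rewrite /orbit_PT D'.
have cPt : (fun s => ball_map (C (s + tau))) @ G --> ball_map (osc w x T0 tau).
  apply/cvgvE; apply: (cvgvZ _ cCt).
  apply: cvgV; first by rewrite gt_eqF// sqrtr_gt0 ltr_pwDl// sqr_ge0.
  apply: continuous_cvg; first exact: sqrt_continuous.
  apply: cvgD; first exact: cvg_cst.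
  by rewrite enorm_sqr; under eq_fun do rewrite enorm_sqr; exact: cvg_dotv.
have {}cTt : (fun s => T (s + tau)) @ G --> osc' w x T0 tau by apply/cvgvE.
exact: (cvg_pair cPt cTt).
Qed.

End NonzeroLimit.

(** * Classification of the omega-limit set *)

(** Limit states exist along refinements of any filter of times going to
    infinity, since (P, T) stays in a compact set. *)
Lemma limit_state_exists {R : realType} {n : nat} (alpha : R) (A : 'M[R]_n)
    (C : R -> 'cV[R]_n) (F : set_system R) :
  alpha < 0 -> A^T = - A -> soliton alpha A C -> Vplus alpha A C != 0 ->
  ProperFilter F -> +oo `<=` F ->
  exists (G : set_system R) x t, [/\ ProperFilter G, F `<=` G, cvgv G C x,
    cvgv G (derive1 C) t &
    limit_state alpha A (Vplus alpha A C * expR (1 / 2)) x t].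
Proof.
move=> a0 As sol V0 FF ooF.
have cK := compact_setX (@compact_cube R n) (@compact_cube R n).
have [[P t] [G [GG FG cX]]] :=
  compact_subfilter FF cK (orbit_PT_in_cube (proj1 sol)).
have ooG : +oo `<=` G by exact: subset_trans FG.
have [x [cC cT _ xt]] := limit_state_of_filter a0 As sol V0 GG ooG cX.
by exists G, x, t.
Qed.

(** The number (- alpha)^(1/2) |L| is one of the frequencies. *)
Lemma limit_state_frequency {R : realType} {n m : nat} (alpha L : R)
    (A : 'M[R]_n) (Omega : 'I_m -> R) (x t : 'cV[R]_n) :
  alpha < 0 -> A^T = - A -> L != 0 -> frequencies A Omega ->
  limit_state alpha A L x t -> exists k, Omega k ^+ 2 = - alpha * L ^+ 2.
Proof.
move=> a0 As L0 [gt0 _ OP] xt.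
pose w := Num.sqrt (- alpha) * `|L|.
have w0 : 0 < w by rewrite mulr_gt0 ?normr_gt0// sqrtr_gt0 oppr_gt0.
have w2 : w ^+ 2 = - alpha * L ^+ 2.
  by rewrite exprMn real_normK ?num_real// sqr_sqrtr// oppr_ge0 ltW.
have [_ H] := eigenvalue_freq As (lt0r_neq0 w0).
have ev : Complex w 0 != 0 /\
    eigenvalue (Complex 0 1 *: complex_mx A) (Complex w 0).
  split; first by rewrite eq_complex /= (gt_eqF w0).
  apply: H; exists x; first exact: limit_state_neq0 a0 xt.
  exact: limit_state_freq_space xt _ w2.
have [k [[wE]|[wE _]]] := (OP _).1 ev; first by exists k; rewrite -wE.
by have := gt0 k; rewrite -[_ k]opprK -wE oppr_gt0 ltNge (ltW w0).
Qed.

(** The values of V_+, from Omega^2 = - alpha L^2 and L = V_+ exp(1/2). *)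
Lemma level_of_frequency {R : realType} (alpha V Omega : R) :
  alpha < 0 -> 0 < Omega ->
  Omega ^+ 2 = - alpha * (V * expR (1 / 2)) ^+ 2 ->
  V = Omega / Num.sqrt (- expR 1 * alpha) \/
  V = - (Omega / Num.sqrt (- expR 1 * alpha)).
Proof.
move=> a0 O0 O2; set c := - expR 1 * alpha.
have c0 : 0 < c by rewrite /c mulNr -mulrN mulr_gt0 ?expR_gt0// oppr_gt0.
have V2 : V ^+ 2 = (Omega / Num.sqrt c) ^+ 2.
  rewrite expr_div_n sqr_sqrtr ?(ltW c0)// O2 exprMn [expR _ ^+ 2]expr2 -expRD.
  rewrite -splitr /c; field.
  by rewrite lt_eqF// gt_eqF// expR_gt0.
by have /eqP := V2; rewrite eqf_sqr => /orP[/eqP->|/eqP->]; [left|right].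
Qed.

(** When the eigenvalue is simple, a complex circle is a sphere of the whole
    frequency space, which is a plane. *)
Lemma complex_circle_simple {R : realType} {n : nat} (A : 'M[R]_n) (w r : R)
    (S : set 'cV[R]_n) : A^T = - A -> w != 0 ->
  simple_eigenvalue (complex_mx A) (Complex 0 w) -> complex_circle A w r S ->
  S = [set y | y \in freq_space A w /\ enorm y = r].
Proof.
move=> As w0 simple [x [xF x0 ->]].
by rewrite -(freq_space_simple As w0 simple xF x0).
Qed.

Theorem lemma8p4 (R : realType) (n : nat) (alpha : R) (A : 'M[R]_n)
    (C : R -> 'cV[R]_n) (m : nat) (Omega : 'I_m -> R)
    (alpha_lt0 : alpha < 0)
    (A_neq0 : A != 0)
    (A_antisym : A^T = - A)
    (C_soliton : soliton alpha A C)
    (Omega_freq : frequencies A Omega) :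
  let W := omega_limit (orbit_PT C) in
  let V := Vplus alpha A C in
  let is_level (k : 'I_m) :=
    V = Omega k / Num.sqrt (- expR 1 * alpha) \/
    V = - (Omega k / Num.sqrt (- expR 1 * alpha)) in
  (V <> 0 ->
     exists2 k, is_level k &
       consists_of_complex_circles A (Omega k) (soliton_radius alpha) W) /\
  ((forall k, simple_eigenvalue (complex_mx A) (Complex 0 (Omega k))) ->
     (forall k, \dim (freq_space A (Omega k)) = 2%N /\
        exists! S, soliton_circle alpha A (Omega k) S) /\
     (V <> 0 ->
        exists2 k, is_level k &
          exists S, [/\ soliton_circle alpha A (Omega k) S,
                        contains_circle W S & asymptotic_to C S])).
Proof.
move=> W V is_level; have [gt0 _ OP] := Omega_freq.
have Oneq0 k : Omega k != 0 by exact: lt0r_neq0.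
pose L := V * expR (1 / 2); pose w := Num.sqrt (- alpha).
have L_neq0 : V <> 0 -> L != 0.
  by move=> /eqP V0; rewrite mulf_neq0// lt0r_neq0// expR_gt0.
(* one frequency serves for all limit states, since V determines Omega k *)
have level : V <> 0 -> exists k, Omega k ^+ 2 = - alpha * L ^+ 2.
  move=> V0; have /eqP V0' := V0.
  have [G [x [t [_ _ _ _ xt]]]] := limit_state_exists alpha_lt0 A_antisym
    C_soliton V0' (@proper_pinfty_nbhs R) (@subset_refl _ _).
  exact: limit_state_frequency (L_neq0 V0) Omega_freq xt.
have circle k x t : L != 0 -> Omega k ^+ 2 = - alpha * L ^+ 2 ->
    limit_state alpha A L x t ->
    parametrized_complex_circle A (Omega k) (soliton_radius alpha) (osc w x t).
  move=> L0 O2 xt; split.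
    exact: (arclength_osc alpha_lt0 A_antisym L0 xt).
  exists x; split; first exact: limit_state_freq_space xt _ O2.
    exact: limit_state_neq0 alpha_lt0 xt.
  exact: range_osc alpha_lt0 A_antisym L0 xt _ (gt0 k) O2.
split=> [V0|simple].
  have /eqP V0' := V0; have [k O2] := level V0.
  exists k; first exact: level_of_frequency O2.
  exists [set c |
    parametrized_complex_circle A (Omega k) (soliton_radius alpha) c
    /\ range (orbit_PT c) `<=` W]; first by move=> c [].
  apply/seteqP; split=> [[P t]|X [c [_ cW] /cW//]].
  move=> /omega_limitP[G [GG ooG cX]].
  have [x [cC cT PE xt]] :=
    limit_state_of_filter alpha_lt0 A_antisym C_soliton V0' GG ooG cX.
  exists (osc w x t).
    split; first exact: circle (L_neq0 V0) O2 xt.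
    exact: (orbit_osc_in_omega_limit alpha_lt0 A_antisym C_soliton V0'
      GG ooG cC cT xt).
  exists 0 => //; rewrite /orbit_PT osc0 PE.
  have w0 : w != 0 by rewrite sqrtr_eq0 -ltNge oppr_gt0.
  by rewrite (vderive_derive1 (vderive_osc x t w0)).2 osc'0.
have nz k : exists2 x, x != 0 & x \in freq_space A (Omega k).
  apply/(eigenvalue_freq A_antisym (Oneq0 k)).
  by apply: (proj2 ((OP _).2 _)); exists k; left.
split=> [k|V0].
  have [x x0 xF] := nz k; split.
    exact: dim_freq_space_simple (simple k) xF x0.
  exists [set y | y \in freq_space A (Omega k) /\
                  enorm y = soliton_radius alpha].
  split=> [|S HS]; last first.
    exact/esym/(complex_circle_simple A_antisym (Oneq0 k) (simple k) HS).
  exists x; split=> //.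
  by rewrite -(freq_space_simple A_antisym (Oneq0 k) (simple k) xF x0).
have /eqP V0' := V0; have [k O2] := level V0.
exists k; first exact: level_of_frequency O2.
exists [set y | y \in freq_space A (Omega k) /\ enorm y = soliton_radius alpha].
have SE x t : limit_state alpha A L x t -> range (osc w x t) =
    [set y | y \in freq_space A (Omega k) /\ enorm y = soliton_radius alpha].
  move=> /(circle _ _ _ (L_neq0 V0) O2)[_ Hc].
  exact: complex_circle_simple A_antisym (Oneq0 k) (simple k) Hc.
have [G [x [t [GG ooG cC cT xt]]]] := limit_state_exists alpha_lt0 A_antisym
  C_soliton V0' (@proper_pinfty_nbhs R) (@subset_refl _ _).
split.
- by rewrite -(SE _ _ xt); have [] := circle _ _ _ (L_neq0 V0) O2 xt.
- exists (osc w x t); split.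
  + exact: (arclength_osc alpha_lt0 A_antisym (L_neq0 V0) xt).
  + exact: SE xt.
  + exact: (orbit_osc_in_omega_limit alpha_lt0 A_antisym C_soliton V0'
      GG ooG cC cT xt).
(* otherwise times at which C is far from the circle accumulate at infinity;
   the limit state obtained along them lies on the circle *)
move=> eps eps0; apply: contrapT => far.
pose good s := exists2 y, (y \in freq_space A (Omega k) /\
  enorm y = soliton_radius alpha) & enorm (C s - y) < eps.
have FF : ProperFilter (within (~` good) (+oo : set_system R)).
  apply: Build_ProperFilter_ex => B HB; apply: contrapT => nB.
  apply: far; apply: (filterS _ (HB : +oo _)) => s Bs; apply: contrapT => ns.
  by apply: nB; exists s; exact: Bs.
have ooF : (+oo : set_system R) `<=` within (~` good) +oo.
  by move=> B; apply: filterS => s Bs _.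
have [H [y [v [HH FH cC' _ yv]]]] :=
  limit_state_exists alpha_lt0 A_antisym C_soliton V0' FF ooF.
have Hbad : H (~` good) by apply: FH; rewrite /within /=; exact: filterE.
have Hgood : H good.
  have cd : cvgv H (fun s => C s - y) 0.
    move=> i; under eq_fun do rewrite !mxE; rewrite mxE -(subrr (y i 0)).
    by apply: cvgB (cC' i) _; exact: cvg_cst.
  have d0 : dotv (C s - y) (C s - y) @[s --> H] --> (0 : R).
    by have /eqP <- : dotv (0 : 'cV[R]_n) 0 == 0;
      [rewrite dotv_eq0|exact: cvg_dotv].
  apply: filterS ((cvgrPdist_lt _ _).1 d0 _ (exprn_gt0 2 eps0)) => s.
  rewrite sub0r normrN ger0_norm ?dotv_ge0// => ds; exists y.
    rewrite -[_ /\ _]/([set y | _ /\ _] y) -(SE _ _ yv).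
    by exists 0 => //; rewrite osc0.
  by rewrite -(@ltr_pXn2r _ 2)// ?nnegrE ?sqrtr_ge0 ?(ltW eps0)// enorm_sqr.
by have [s []] := filter_ex (filterI Hbad Hgood).
Qed.
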